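(* Let $R=k[X_0,\ldots,X_n]$ with $k$ a field, $M$ a finitely generated graded $R$-module of dimension $d$, $\mu\in\mathbb{Z}\cup\{-\infty\}$, and let $\gamma=(\gamma_1,\ldots,\gamma_t)$ be a homogeneous (partial) system of parameters of $M$ that is a regular sequence on $M$ outside $V(J)$, where $J$ is a homogeneous ideal of $R$ with $\dim M/JM\leq\varepsilon$. Let $0\leq\ell<t$, set $\sigma_\ell:=\deg\gamma_1+\cdots+\deg\gamma_\ell-\ell$, and assume either that (i) $\varepsilon\leq i<d-\ell$ and $\gamma_j\in\widehat{\mathfrak{K}}^{\mu}_M$ for $j\leq\ell+1$; or (ii) $i\geq\varepsilon$ and $\gamma_j\in\mathfrak{K}^{\mu}_M$ for $j\leq\ell+1$. Then $$H^i_{\mathfrak m}(M/(\gamma_1,\ldots,\gamma_\ell)M)_\nu\subseteq H^i_{\mathfrak m}(M/(\gamma_1,\ldots,\gamma_{\ell+1})M)_\nu\qquad\forall\,\nu>\mu-i+\sigma_\ell .$$ In particular, if $\gamma_j\in\widehat{\mathfrak{K}}^{\mu}_M$ for all $j$ and $\varepsilon\leq i\leq d-t$, then $$H^i_{\mathfrak m}(M)_\nu\subseteq H^i_{\mathfrak m}(M/(\gamma_1,\ldots,\gamma_t)M)_\nu\qquad\forall\,\nu>\mu-i+\sigma_{t-1}.$$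
   Context: $R$ has its standard grading, $\mathfrak m=(X_0,\ldots,X_n)$, $H^i_{\mathfrak m}$ is local cohomology. The inclusions mean that the canonical maps induced by the quotient maps of modules are injective in degree $\nu$. For a tuple $z$ of homogeneous elements of $R$, $H^i(z;M)$ is Koszul cohomology, graded so that the Koszul differentials have degree $0$ and $K^0(z;M)=M$. For a graded $R$-module $H$ and $N\in\mathbb{Z}\cup\{-\infty\}$, $\mathrm{Ann}^{>N}_R(H):=\{x\in R\mid (xH)_\nu=0\ \ \forall\nu\in\mathbb{Z},\ \nu>N\}$ (a homogeneous ideal). Let $\mathcal{Z}_M$ be the set of tuples $z$ of homogeneous elements of $R$ such that $\dim M/(z)M=0$, and $$\mathfrak{K}^{\mu}_{M}:=\bigcap_{z\in\mathcal{Z}_M}\bigcap_{i}\mathrm{Ann}^{>\mu-i}_R(H^i(z;M)),\qquad \widehat{\mathfrak{K}}^{\mu}_{M}:=\bigcap_{z\in\mathcal{Z}_M}\bigcap_{i<d}\mathrm{Ann}^{>\mu-i}_R(H^i(z;M)).$$ A homogeneous (partial) system of parameters $(\gamma_1,\ldots,\gamma_t)$ of $M$ is a sequence of homogeneous elements of positive degree with $\dim M/(\gamma)M=d-t$. It is a regular sequence on $M$ outside $V(J)$ if for every prime $\mathfrak p\not\supseteq J$, each $\gamma_{j}$ is a nonzerodivisor on $M_{\mathfrak p}/(\gamma_1,\ldots,\gamma_{j-1})M_{\mathfrak p}$ (these quotients being allowed to vanish). *)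

(* Defs.v *)
From HB Require Import structures.
From mathcomp Require Import all_boot all_order all_algebra.
From mathcomp Require Import boolp.
From mathcomp Require Import generic_quotient ring_quotient.
From mathcomp Require Import mpoly ring.

Set Implicit Arguments.
Unset Strict Implicit.
Unset Printing Implicit Defensive.

Import Order.TTheory GRing.Theory Num.Theory.
Local Open Scope ring_scope.
Local Open Scope quotient_scope.

(* Subsets are boolean predicates, made from propositions by `[< _ >]; with the
   axioms of boolp no generality is lost. *)

Section QuotientModule.
Variables (R : comNzRingType) (M : lmodType R).

Lemma submod_oppr_closed (N : submodClosed M) : oppr_closed N.
Proof. by move=> x xN; rewrite -scaleN1r rpredZ. Qed.

(* submodClosed does not provide closure under opposites, because it also covers
   semimodules; the quotient of ring_quotient needs it. *)
Definition submod_zmod (N : submodClosed M) : zmodClosed M :=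
  HB.pack (N : {pred M})
    (GRing.isOppClosed.Build M N (@submod_oppr_closed N))
    (GRing.isAddClosed.Build M N (conj (rpred0 N) (@rpredD _ N))).

Definition modquot (N : submodClosed M) : Type := Quotient.quot (submod_zmod N).

Variable N : submodClosed M.
HB.instance Definition _ := ZmodQuotient.on (modquot N).

Definition mq_scale (a : R) (x : modquot N) : modquot N := \pi_(modquot N) (a *: repr x).

Lemma mq_eqP (x y : M) : \pi_(modquot N) x = \pi_(modquot N) y <-> x - y \in N.
Proof. by split=> [/eqP|?]; [|apply/eqP]; rewrite -Quotient.idealrBE. Qed.

Lemma mq_scale_pi a x : mq_scale a (\pi_(modquot N) x) = \pi_(modquot N) (a *: x).
Proof.
by apply/mq_eqP; rewrite -scalerBr rpredZ //; apply/mq_eqP; rewrite reprK.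
Qed.

Lemma mq_addE x y : \pi_(modquot N) x + \pi_(modquot N) y = \pi_(modquot N) (x + y).
Proof. by rewrite -[LHS]Quotient.pi_add. Qed.

Lemma mq_ind (P : modquot N -> Prop) :
  (forall x, P (\pi_(modquot N) x)) -> forall x, P x.
Proof. by move=> h x; rewrite -[x]reprK. Qed.

Lemma mq_scaleA a b v : mq_scale a (mq_scale b v) = mq_scale (a * b) v.
Proof. by elim/mq_ind: v => v; rewrite !mq_scale_pi scalerA. Qed.
Lemma mq_scale1 : left_id 1 mq_scale.
Proof. by elim/mq_ind=> v; rewrite mq_scale_pi scale1r. Qed.
Lemma mq_scaleDr : right_distributive mq_scale +%R.
Proof.
move=> a; elim/mq_ind=> u; elim/mq_ind=> v.
by rewrite mq_addE !mq_scale_pi scalerDr mq_addE.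
Qed.
Lemma mq_scaleDl v : {morph mq_scale^~ v : a b / a + b}.
Proof.
by move=> a b; elim/mq_ind: v => v; rewrite !mq_scale_pi scalerDl mq_addE.
Qed.
HB.instance Definition _ := GRing.Zmodule_isLmodule.Build R (modquot N)
  mq_scaleA mq_scale1 mq_scaleDr mq_scaleDl.

Definition mq_proj (x : M) : modquot N := \pi_(modquot N) x.

(* The image of a family of homogeneous parts. *)
Definition mq_gr (gr : int -> M -> Prop) (nu : int) (x : modquot N) : Prop :=
  exists2 m, gr nu m & x = mq_proj m.
End QuotientModule.

(* The canonical map M/N -> M/N', for N included in N'. *)
Definition mq_map (R : comNzRingType) (M : lmodType R) (N N' : submodClosed M)
  (x : modquot N) : modquot N' := mq_proj N' (repr x).

Lemma mq_mapE (R : comNzRingType) (M : lmodType R) (N N' : submodClosed M) x :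
  {subset N <= N'} -> mq_map N' (mq_proj N x) = mq_proj N' x.
Proof. by move=> s; apply/mq_eqP/s/mq_eqP; rewrite reprK. Qed.

Section Smul.
Variables (R : comNzRingType) (A : {pred R}) (M : lmodType R).

(* A M, the submodule of M generated by the products a m with a in A. *)
Definition smul : {pred M} := fun x => `[< exists2 s : seq (R * M),
  all (fun p => p.1 \in A) s & x = \sum_(p <- s) p.1 *: p.2 >].

Lemma smul_closed : submod_closed smul.
Proof.
split=> [|a _ _ /asboolP[s sA ->] /asboolP[s' sA' ->]].
  by apply/asboolP; exists [::]; rewrite ?big_nil.
apply/asboolP; exists ([seq (p.1, a *: p.2) | p <- s] ++ s').
  by rewrite all_cat sA' all_map andbT.
rewrite big_cat big_map scaler_sumr; congr (_ + _).
by apply: eq_bigr => p _; rewrite !scalerA mulrC.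
Qed.
HB.instance Definition _ := GRing.isSubmodClosed.Build R M smul smul_closed.
End Smul.
Arguments smul {R} A M.

Section Localization.
Variables (R : comNzRingType) (S : mulrClosed R) (M : lmodType R).

Definition denom := {s : R | s \in S}.
Definition denom1 : denom := exist _ 1 (rpred1 S).
Definition denomM (s t : denom) : denom :=
  exist _ (val s * val t) (rpredM (valP s) (valP t)).

Definition loc_equiv (x y : M * denom) : bool :=
  `[< exists2 u, u \in S & u *: (val y.2 *: x.1) = u *: (val x.2 *: y.1) >].

Lemma loc_equivP : equiv_class_of loc_equiv.
Proof.
split=> [x|x y|y x z].
- by apply/asboolP; exists 1; rewrite ?rpred1.
- by apply: asbool_equiv_eq; split=> -[u uS e]; exists u.
move=> /asboolP[u uS e] /asboolP[v vS f]; apply/asboolP.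
exists (u * v * val y.2); first by rewrite !rpredM ?(valP y.2).
transitivity ((v * val z.2) *: (u *: (val y.2 *: x.1))).
  by rewrite !scalerA; congr (_ *: _); ring.
transitivity ((u * val x.2) *: (v *: (val z.2 *: y.1))).
  by rewrite e !scalerA; congr (_ *: _); ring.
by rewrite f !scalerA; congr (_ *: _); ring.
Qed.
Canonical loc_equivRel := EquivRelPack loc_equivP.
Canonical loc_encModRel := defaultEncModRel loc_equiv.

(* S^-1 M; its elements are the fractions m / s. *)
Definition loc : Type := {eq_quot loc_equiv}.
HB.instance Definition _ := EqQuotient.on loc.
HB.instance Definition _ := Choice.on loc.

Definition frac (m : M) (s : denom) : loc := \pi_loc (m, s).

Lemma fracP m s m' s' : frac m s = frac m' s' <->
  exists2 u, u \in S & u *: (val s' *: m) = u *: (val s *: m').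
Proof.
split=> [e|e]; first by apply/asboolP; move/eqP: e; rewrite /frac piE.
by apply/eqP; rewrite /frac piE; apply/asboolP.
Qed.

Lemma fracW (P : loc -> Prop) : (forall m s, P (frac m s)) -> forall x, P x.
Proof. by move=> h x; rewrite -[x]reprK; case: (repr x) => m s; apply: h. Qed.

Lemma frac_repr x : frac (repr x).1 (repr x).2 = x.
Proof. by rewrite /frac -surjective_pairing reprK. Qed.

Definition loc_add (x y : loc) : loc :=
  frac (val (repr y).2 *: (repr x).1 + val (repr x).2 *: (repr y).1)
       (denomM (repr x).2 (repr y).2).
Definition loc_scale (a : R) (x : loc) : loc := frac (a *: (repr x).1) (repr x).2.

Lemma loc_addE m s m' s' :
  loc_add (frac m s) (frac m' s') = frac (val s' *: m + val s *: m') (denomM s s').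
Proof.
rewrite /loc_add.
case: (repr (frac m s)) (frac_repr (frac m s)) => m1 s1 /= /fracP[u uS e].
case: (repr (frac m' s')) (frac_repr (frac m' s')) => m2 s2 /= /fracP[v vS f].
apply/fracP; exists (u * v); rewrite ?rpredM // !scalerDr; congr (_ + _).
  transitivity ((v * val s' * val s2) *: (u *: (val s *: m1))).
    by rewrite !scalerA; congr (_ *: _); rewrite /=; ring.
  by rewrite e !scalerA; congr (_ *: _); rewrite /=; ring.
transitivity ((u * val s * val s1) *: (v *: (val s' *: m2))).
  by rewrite !scalerA; congr (_ *: _); rewrite /=; ring.
by rewrite f !scalerA; congr (_ *: _); rewrite /=; ring.
Qed.

Lemma loc_scaleE a m s : loc_scale a (frac m s) = frac (a *: m) s.
Proof.
rewrite /loc_scale.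
case: (repr (frac m s)) (frac_repr (frac m s)) => m1 s1 /= /fracP[u uS e].
apply/fracP; exists u => //.
transitivity (a *: (u *: (val s *: m1))).
  by rewrite !scalerA; congr (_ *: _); ring.
by rewrite e !scalerA; congr (_ *: _); ring.
Qed.

Lemma fracM (c : denom) m s : frac (val c *: m) (denomM c s) = frac m s.
Proof.
by apply/fracP; exists 1; rewrite ?rpred1 // !scalerA; congr (_ *: _);
  rewrite /=; ring.
Qed.

Lemma loc_addA : associative loc_add.
Proof.
elim/fracW=> m s; elim/fracW=> m' s'; elim/fracW=> m'' s''.
rewrite !loc_addE; apply/fracP; exists 1; rewrite ?rpred1 // !scale1r.
rewrite !scalerDr !scalerA addrA; congr (_ *: _ + _ *: _ + _ *: _); rewrite /=; ring.
Qed.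
Lemma loc_addC : commutative loc_add.
Proof.
elim/fracW=> m s; elim/fracW=> m' s'.
rewrite !loc_addE addrC; apply/fracP; exists 1; rewrite ?rpred1 //=.
by rewrite [val s * _]mulrC.
Qed.
Lemma loc_add0 : left_id (frac 0 denom1) loc_add.
Proof. by elim/fracW=> m s; rewrite loc_addE scaler0 add0r; apply: fracM. Qed.
Definition loc_opp (x : loc) : loc := loc_scale (- 1) x.
Lemma loc_addN : left_inverse (frac 0 denom1) loc_opp loc_add.
Proof.
elim/fracW=> m s; rewrite /loc_opp loc_scaleE loc_addE scaleN1r scalerN addNr.
by apply/fracP; exists 1; rewrite ?rpred1 // !scaler0.
Qed.
HB.instance Definition _ :=
  GRing.isZmodule.Build loc loc_addA loc_addC loc_add0 loc_addN.

Lemma loc_scaleA a b v : loc_scale a (loc_scale b v) = loc_scale (a * b) v.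
Proof. by elim/fracW: v => m s; rewrite !loc_scaleE scalerA. Qed.
Lemma loc_scale1 : left_id 1 loc_scale.
Proof. by elim/fracW=> m s; rewrite loc_scaleE scale1r. Qed.
Lemma loc_scaleDr : right_distributive loc_scale +%R.
Proof.
move=> a; elim/fracW=> m s; elim/fracW=> m' s'.
rewrite -![_ + _]/(loc_add _ _) loc_addE !loc_scaleE loc_addE.
by rewrite scalerDr !scalerA ![a * _]mulrC.
Qed.
Lemma loc_scaleDl v : {morph loc_scale^~ v : a b / a + b}.
Proof.
move=> a b; elim/fracW: v => m s.
rewrite -[RHS]/(loc_add _ _) !loc_scaleE loc_addE -scalerDr -scalerDl.
by rewrite fracM.
Qed.
HB.instance Definition _ := GRing.Zmodule_isLmodule.Build R loc
  loc_scaleA loc_scale1 loc_scaleDr loc_scaleDl.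

Lemma fracD m s m' s' :
  frac m s + frac m' s' = frac (val s' *: m + val s *: m') (denomM s s').
Proof. exact: loc_addE. Qed.
Lemma fracZ a m s : a *: frac m s = frac (a *: m) s.
Proof. exact: loc_scaleE. Qed.
End Localization.

(* The canonical map S^-1 M -> S'^-1 M, for S included in S'. *)
Section LocIncl.
Variables (R : comNzRingType) (S S' : mulrClosed R) (M : lmodType R).
Hypothesis sSS' : {subset S <= S'}.

Definition denom_incl (s : denom S) : denom S' := exist _ (val s) (sSS' (valP s)).
Definition loc_incl (x : loc S M) : loc S' M :=
  frac (repr x).1 (denom_incl (repr x).2).

Lemma loc_inclE m s : loc_incl (frac m s) = frac m (denom_incl s).
Proof.
rewrite /loc_incl.
case: (repr (frac m s)) (frac_repr (frac m s)) => m1 s1 /= /fracP[u uS e].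
by apply/fracP; exists u => //; apply: sSS'.
Qed.

Lemma loc_incl_linear : linear loc_incl.
Proof.
move=> a; elim/fracW=> m s; elim/fracW=> m' s'.
rewrite fracZ fracD !loc_inclE fracZ fracD; congr frac.
exact/val_inj.
Qed.
HB.instance Definition _ :=
  GRing.isLinear.Build R (loc S M) (loc S' M) _ loc_incl loc_incl_linear.
End LocIncl.

(* The map S^-1 A -> S^-1 B induced by f. *)
Section LocMap.
Variables (R : comNzRingType) (S : mulrClosed R) (A B : lmodType R).

Definition loc_map (f : A -> B) (x : loc S A) : loc S B :=
  frac (f (repr x).1) (repr x).2.

Lemma loc_mapE (f : {linear A -> B}) m s : loc_map f (frac m s) = frac (f m) s.
Proof.
rewrite /loc_map.
case: (repr (frac m s)) (frac_repr (frac m s)) => m1 s1 /= /fracP[u uS e].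
have fZ c y : f (c *: y) = c *: f y by exact: linearZ.
by apply/fracP; exists u; rewrite // -!fZ e.
Qed.
End LocMap.

(* Koszul and Cech complexes have the same shape: a module V S for each set of
   indices S, placed in cohomological degree #|S|, with maps
   V (S minus j) -> V S for j in S. *)
Section Cube.
Variables (R : comNzRingType) (r : nat) (V : {set 'I_r} -> lmodType R).
Variable rho : forall (j : 'I_r) (S : {set 'I_r}), {linear V (S :\ j) -> V S}.

Definition cochain : Type := {dffun forall S : {set 'I_r}, V S}.
HB.instance Definition _ := Choice.on cochain.
Implicit Types f g h : cochain.

Definition cochain_of (F : forall S, V S) : cochain := [ffun S => F S].
Definition coch_add f g := cochain_of (fun S => f S + g S).
Definition coch_opp f := cochain_of (fun S => - f S).
Definition coch_scale (a : R) f := cochain_of (fun S => a *: f S).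

Lemma coch_addA : associative coch_add.
Proof. by move=> f g h; apply/ffunP => S; rewrite !ffunE addrA. Qed.
Lemma coch_addC : commutative coch_add.
Proof. by move=> f g; apply/ffunP => S; rewrite !ffunE addrC. Qed.
Lemma coch_add0 : left_id (cochain_of (fun=> 0)) coch_add.
Proof. by move=> f; apply/ffunP => S; rewrite !ffunE add0r. Qed.
Lemma coch_addN : left_inverse (cochain_of (fun=> 0)) coch_opp coch_add.
Proof. by move=> f; apply/ffunP => S; rewrite !ffunE addNr. Qed.
HB.instance Definition _ :=
  GRing.isZmodule.Build cochain coch_addA coch_addC coch_add0 coch_addN.

Lemma coch_scaleA a b f : coch_scale a (coch_scale b f) = coch_scale (a * b) f.
Proof. by apply/ffunP => S; rewrite !ffunE scalerA. Qed.
Lemma coch_scale1 : left_id 1 coch_scale.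
Proof. by move=> f; apply/ffunP => S; rewrite !ffunE scale1r. Qed.
Lemma coch_scaleDr : right_distributive coch_scale +%R.
Proof. by move=> a f g; apply/ffunP => S; rewrite !ffunE scalerDr. Qed.
Lemma coch_scaleDl f : {morph coch_scale^~ f : a b / a + b}.
Proof. by move=> a b; apply/ffunP => S; rewrite !ffunE scalerDl. Qed.
HB.instance Definition _ := GRing.Zmodule_isLmodule.Build R cochain
  coch_scaleA coch_scale1 coch_scaleDr coch_scaleDl.

Lemma cochZD a f g S : (a *: f + g) S = a *: f S + g S.
Proof. by rewrite !ffunE. Qed.

Definition cdiff f : cochain := cochain_of (fun S =>
  \sum_(j in S) (-1) ^+ #|[set k in S | (k < j)%N]| *: rho j S (f (S :\ j))).

Lemma cdiff_linear : linear cdiff.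
Proof.
move=> a f g; apply/ffunP => S; rewrite cochZD !ffunE scaler_sumr -big_split.
apply: eq_bigr => j _; rewrite cochZD linearD linearZ scalerDr /=.
by rewrite !scalerA mulrC.
Qed.
HB.instance Definition _ :=
  GRing.isLinear.Build R cochain cochain _ cdiff cdiff_linear.

(* The cochains of cohomological degree i. *)
Definition in_deg (i : nat) f : bool := [forall S : {set 'I_r}, (#|S| != i) ==> (f S == 0)].

Definition cocycle (i : nat) : {pred cochain} :=
  fun f => in_deg i f && (cdiff f == 0).
Lemma cocycle_closed i : submod_closed (cocycle i).
Proof.
split=> [|a f g].
  rewrite unfold_in /cocycle linear0 eqxx andbT.
  by apply/forallP => S; rewrite ffunE eqxx implybT.
rewrite !unfold_in => /andP[/forallP fi /eqP df] /andP[/forallP gi /eqP dg].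
rewrite /cocycle linearD linearZ /= df dg scaler0 addr0 eqxx andbT.
apply/forallP => S; apply/implyP => Si; rewrite cochZD.
by rewrite (eqP (implyP (fi S) Si)) (eqP (implyP (gi S) Si)) scaler0 addr0.
Qed.
HB.instance Definition _ i :=
  GRing.isSubmodClosed.Build R cochain (cocycle i) (cocycle_closed i).

Record cocycles (i : nat) : Type :=
  Cocycle { cocycle_val :> cochain; _ : cocycle_val \in cocycle i }.
HB.instance Definition _ i := [isSub for @cocycle_val i].
HB.instance Definition _ i := [Choice of cocycles i by <:].
HB.instance Definition _ i := [SubChoice_isSubLmodule of cocycles i by <:].

Definition coboundary (i : nat) : {pred cocycles i} := fun z =>
  `[< exists2 g : cochain, [forall S : {set 'I_r}, (#|S|.+1 != i) ==> (g S == 0)]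
                         & val z = cdiff g >].
Lemma coboundary_closed i : submod_closed (@coboundary i).
Proof.
split=> [|a z z' /asboolP[g /forallP gi e] /asboolP[g' /forallP gi' e']].
  apply/asboolP; exists 0; last by rewrite !linear0.
  by apply/forallP => S; rewrite ffunE eqxx implybT.
apply/asboolP; exists (a *: g + g'); last first.
  by rewrite [RHS]linearP /= -e -e'.
apply/forallP => S; apply/implyP => Si; rewrite cochZD.
by rewrite (eqP (implyP (gi S) Si)) (eqP (implyP (gi' S) Si)) scaler0 addr0.
Qed.
HB.instance Definition _ i := GRing.isSubmodClosed.Build R (cocycles i)
  (@coboundary i) (coboundary_closed i).

Definition cohom (i : nat) : Type := modquot (@coboundary i).
HB.instance Definition _ i := GRing.Lmodule.on (cohom i).

(* The homogeneous parts of the cohomology, given those of each V S. *)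
Definition cohom_gr (gr : forall S, int -> V S -> Prop) (i : nat) (nu : int)
  (x : cohom i) : Prop :=
  exists2 z : cocycles i, (forall S, gr S nu (cocycle_val z S)) & x = mq_proj _ z.
End Cube.

(* The map induced on cohomology by maps phi S that commute with rho. *)
Section CohomMap.
Variables (R : comNzRingType) (r : nat) (V V' : {set 'I_r} -> lmodType R).
Variable rho : forall (j : 'I_r) (S : {set 'I_r}), {linear V (S :\ j) -> V S}.
Variable rho' : forall (j : 'I_r) (S : {set 'I_r}), {linear V' (S :\ j) -> V' S}.

Definition coch_map (phi : forall S, V S -> V' S) (f : cochain V) : cochain V' :=
  cochain_of (fun S => phi S (f S)).

Definition cohom_map (phi : forall S, V S -> V' S) (i : nat)
    (x : cohom rho i) : cohom rho' i :=
  mq_proj (@coboundary _ _ _ rho' i) (insubd 0 (coch_map phi (cocycle_val (repr x)))).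

Lemma cohom_mapE (phi : forall S, {linear V S -> V' S}) i
    (z : cocycles rho i) (z' : cocycles rho' i) :
  (forall j S x, phi S (rho j S x) = rho' j S (phi (S :\ j) x)) ->
  cocycle_val z' = coch_map phi (cocycle_val z) ->
  cohom_map phi (mq_proj _ z) = mq_proj _ z'.
Proof.
move=> phi_rho ez'.
have dphi f : cdiff rho' (coch_map phi f) = coch_map phi (cdiff rho f).
  apply/ffunP => S; rewrite !ffunE linear_sum; apply: eq_bigr => j _.
  by rewrite linearZ phi_rho ffunE.
have phi0 (P : pred {set 'I_r}) (f : cochain V) : [forall S, P S ==> (f S == 0)] ->
    [forall S, P S ==> (coch_map phi f S == 0)].
  move=> /forallP h; apply/forallP => S; apply/implyP => PS.
  by rewrite ffunE (eqP (implyP (h S) PS)) linear0.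
rewrite /cohom_map; set w := repr _.
have wz : coch_map phi (cocycle_val w) \in cocycle rho' i.
  have /andP[wi /eqP dw] : cocycle_val w \in cocycle rho i := valP w.
  apply/andP; split; first exact: phi0.
  by rewrite dphi dw; apply/eqP/ffunP => S; rewrite !ffunE linear0.
have : w - z \in @coboundary _ _ _ rho i by apply/mq_eqP; rewrite reprK.
case/asboolP => g gi e; apply/mq_eqP/asboolP; exists (coch_map phi g).
  exact: phi0.
rewrite dphi -e; apply/ffunP => S.
have -> : val (insubd 0 (coch_map phi (cocycle_val w)) - z') =
    coch_map phi (cocycle_val w) - cocycle_val z' :> cochain V'.
  by rewrite raddfB /= insubdK.
by rewrite ez' raddfB !ffunE raddfB.
Qed.
End CohomMap.

(* A family gr of subsets of M, meant as nu |-> M_nu. *)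
Section Graded.
Variables (k : fieldType) (n : nat).
Local Notation R := {mpoly k[n.+1]}.

Definition gr_decomp (M : lmodType R) (gr : int -> M -> Prop) (f : int -> M)
    (x : M) : Prop :=
  (forall nu, gr nu (f nu)) /\
  exists s : seq int, [/\ uniq s, forall nu, nu \notin s -> f nu = 0
                        & x = \sum_(nu <- s) f nu].

Definition is_grading (M : lmodType R) (gr : int -> M -> Prop) : Prop :=
  [/\ forall nu, gr nu 0 /\ forall x y, gr nu x -> gr nu y -> gr nu (x - y),
      forall (d : nat) (p : R) nu x, p \is d.-homog -> gr nu x ->
        gr (nu + d%:Z) (p *: x),
      forall x, exists f, gr_decomp gr f x
    & forall x f g, gr_decomp gr f x -> gr_decomp gr g x -> f =1 g].

Definition fin_gen (M : lmodType R) : Prop :=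
  exists s : seq M, forall x, exists c : nat -> R,
    x = \sum_(i < size s) c i *: nth 0 s i.

Definition homog_ideal (J : {pred R}) : Prop :=
  [/\ 0 \in J, {in J &, forall p q, p + q \in J},
      forall a, {in J, forall p, a * p \in J}
    & forall d, {in J, forall p, pihomog mdeg d p \in J}].

(* Krull dimension, from strict chains p_0 < ... < p_(m-1) of primes containing
   Ann M; the zero module has dimension -1. *)
Definition prime_chain (M : lmodType R) (m : nat) (c : 'I_m -> prime_idealr R) :=
  (forall i a, (forall x : M, a *: x = 0) -> a \in c i) /\
  forall i j : 'I_m, (i < j)%N ->
    {subset c i <= c j} /\ ~ {subset c j <= c i}.

Definition dim_le (M : lmodType R) (d : int) : Prop :=
  forall m (c : 'I_m -> prime_idealr R), prime_chain M c -> m%:Z <= d + 1.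

Definition has_dim (M : lmodType R) (d : int) : Prop :=
  dim_le M d /\
  exists m (c : 'I_m -> prime_idealr R), prime_chain M c /\ m%:Z = d + 1.

(* M / (s) M *)
Definition quo_seq (M : lmodType R) (s : seq R) : lmodType R :=
  modquot (smul (mem s) M).

Definition quo_seq_map (M : lmodType R) (s s' : seq R) :
  quo_seq M s -> quo_seq M s' := @mq_map _ M _ _.

(* Koszul cohomology H^i(z; M). The summand of K^i(z; M) with index set S is
   M(sum of the deg z_j, j in S), so that the differential has degree 0. *)
Section Koszul.
Variables (M : lmodType R) (r : nat) (z : r.-tuple R).

Definition koszul_map (j : 'I_r) (S : {set 'I_r}) : {linear M -> M} :=
  *:%R (tnth z j).

Definition koszul (i : nat) : lmodType R := cohom koszul_map i.

Definition koszul_gr (gr : int -> M -> Prop) (e : r.-tuple nat) (i : nat) :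
    int -> koszul i -> Prop :=
  @cohom_gr _ _ _ koszul_map (fun S nu => gr (nu + \sum_(j in S) (tnth e j)%:Z)) i.
End Koszul.

(* Local cohomology with support in (X_0, ..., X_n), as the cohomology of the
   Cech complex on the variables. Localizing at the monomials in the X_j, j in S,
   amounts to inverting their product. *)
Section Cech.
Definition monoms (S : {set 'I_n.+1}) : {pred R} := fun p =>
  `[< exists2 m : 'X_{1..n.+1}, forall j, j \notin S -> m j = 0%N & p = 'X_[m] >].

Lemma monoms_closed S : mulr_closed (monoms S).
Proof.
split=> [|_ _ /asboolP[m m0 ->] /asboolP[m' m'0 ->]]; apply/asboolP.
  by exists 0%MM; rewrite ?mpolyX0 // => j _; rewrite mnm0E.
by exists (m + m')%MM; rewrite ?mpolyXD // => j jS; rewrite mnmDE m0 ?m'0.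
Qed.
HB.instance Definition _ S := GRing.isMulClosed.Build R (monoms S) (monoms_closed S).

Lemma monoms_sub j (S : {set 'I_n.+1}) : {subset monoms (S :\ j) <= monoms S}.
Proof.
move=> _ /asboolP[m m0 ->]; apply/asboolP; exists m => // l lS.
by rewrite m0 // inE negb_and lS orbT.
Qed.

Variable M : lmodType R.
Definition cech_mod (S : {set 'I_n.+1}) : lmodType R := loc (monoms S) M.

Definition cech_map (j : 'I_n.+1) (S : {set 'I_n.+1}) :
  {linear cech_mod (S :\ j) -> cech_mod S} := @loc_incl R _ _ M (@monoms_sub j S).

Definition loc_cohom (i : nat) : lmodType R := cohom cech_map i.

Definition cech_gr (gr : int -> M -> Prop) (S : {set 'I_n.+1}) (nu : int)
    (x : cech_mod S) : Prop :=
  exists m (s : denom (monoms S)) (d : nat),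
    [/\ val s \is d.-homog, gr (nu + d%:Z) m & x = frac m s].

Definition loc_cohom_gr (gr : int -> M -> Prop) (i : nat) :
    int -> loc_cohom i -> Prop :=
  @cohom_gr _ _ _ cech_map (cech_gr gr) i.
End Cech.

Definition loc_cohom_map (A B : lmodType R) (f : A -> B) (i : nat) :
    loc_cohom A i -> loc_cohom B i :=
  @cohom_map _ _ _ _ (@cech_map A) (@cech_map B) (fun S => @loc_map _ _ A B f) i.

(* Z u {-oo}, with None for -oo. *)
Definition addz (N : option int) (i : int) : option int := omap (fun m => m + i) N.
Definition gtz (nu : int) (N : option int) : bool :=
  if N is Some m then m < nu else true.

(* Ann^{>N}(H): the components of the elements of x H of degree > N vanish. *)
Definition ann_above (H : lmodType R) (gr : int -> H -> Prop) (N : option int)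
    (x : R) : Prop :=
  forall nu, gtz nu N -> forall h f, gr_decomp gr f (x *: h) -> f nu = 0.

(* (z, e) stands for an element of Z_M together with the degrees of its entries.
   The zero polynomial is homogeneous of every degree, but may not be given
   degree 0: this would introduce unlimited unshifted summands in the Koszul
   cohomology. With a positive degree it adds no condition below. *)
Definition in_ZM (M : lmodType R) (r : nat) (z : r.-tuple R) (e : r.-tuple nat) :=
  (forall j, tnth z j \is (tnth e j).-homog /\
             (tnth z j = 0 -> (0 < tnth e j)%N)) /\
  has_dim (quo_seq M z) 0.

Definition frakK (M : lmodType R) (gr : int -> M -> Prop) (mu : option int)
    (x : R) : Prop :=
  forall r (z : r.-tuple R) (e : r.-tuple nat), in_ZM M z e ->
  forall i : nat, ann_above (@koszul_gr M r z gr e i) (addz mu (- i%:Z)) x.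

Definition frakK_hat (M : lmodType R) (gr : int -> M -> Prop) (d : int)
    (mu : option int) (x : R) : Prop :=
  forall r (z : r.-tuple R) (e : r.-tuple nat), in_ZM M z e ->
  forall i : nat, i%:Z < d -> ann_above (@koszul_gr M r z gr e i) (addz mu (- i%:Z)) x.

(* e is the tuple of the degrees of gamma. *)
Definition partial_sop (M : lmodType R) (d : int) (t : nat) (gamma : t.-tuple R)
    (e : t.-tuple nat) : Prop :=
  (forall j, tnth gamma j \is (tnth e j).-homog /\ (0 < tnth e j)%N) /\
  has_dim (quo_seq M gamma) (d - t%:Z).

Definition prime_compl (p : prime_idealr R) : {pred R} := fun x => x \notin p.
Lemma prime_compl_closed p : mulr_closed (prime_compl p).
Proof.
have pE x : (x \in prime_compl p) = (x \notin p) by [].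
split=> [|x y]; rewrite !pE ?idealr1 // => xp yp.
by rewrite prime_idealrM negb_or xp.
Qed.
HB.instance Definition _ p :=
  GRing.isMulClosed.Build R (prime_compl p) (prime_compl_closed p).

Definition regular_outside (M : lmodType R) (J : {pred R}) (t : nat)
    (gamma : t.-tuple R) : Prop :=
  forall p : prime_idealr R, ~ {subset J <= p} -> forall j : 'I_t,
  forall y : quo_seq (loc (prime_compl p) M) (take j gamma),
    tnth gamma j *: y = 0 -> y = 0.

Definition inj_in_degree (A B : lmodType R) (grA : int -> A -> Prop) (nu : int)
    (f : A -> B) : Prop :=
  forall x y, grA nu x -> grA nu y -> f x = f y -> x = y.

Definition sigma (t : nat) (e : t.-tuple nat) (l : nat) : int :=
  (sumn (take l e))%:Z - l%:Z.
End Graded.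

(* Main.v *)
Require Import Defs.
From HB Require Import structures.
From mathcomp Require Import all_boot all_order all_algebra.
From mathcomp Require Import boolp ring_quotient ring zify mpoly.
From mathcomp Require classical_sets.
Set Implicit Arguments.
Unset Strict Implicit.
Unset Printing Implicit Defensive.
Import Order.TTheory GRing.Theory Num.Theory.
Local Open Scope ring_scope.
Local Notation frac := Defs.frac.

(* Represent a class of H^i_m(M / P) by a cochain of the Koszul complex K(X_0^N, ..., X_n^N; M) whose
   coboundary has values in P; it vanishes if and only if, after raising N, it is a coboundary modulo P.

   Put M_q = M / (gamma_1, ..., gamma_q) M. The kernel A_q of gamma_(q+1) on M_q is killed, element by
   element, by powers of the annihilator of M / J M, since gamma is regular outside V(J). Hence the
   local cohomology of A_q vanishes above degree eps. For i >= eps this makes the kernel of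
   H^i_m(M_l) -> H^i_m(M_(l+1)) equal to gamma_(l+1) H^i_m(M_l), and it makes every class of H^i_m(M_l)
   come from a class of H^(i+l)(gamma_1, ..., gamma_l, X_0^N, ..., X_n^N; M) for N large. The
   hypothesis on gamma_(l+1) kills the products of such classes with gamma_(l+1) in degrees
   > mu - i - l, and passing to the component at gamma_1, ..., gamma_l shifts degrees by
   deg gamma_1 + ... + deg gamma_l.

   The vanishing needs eps elements of m which generate m up to radical, locally at m and modulo
   the annihilator of M / J M; they come from Kronecker's theorem, without noetherianity. *)

(** * Koszul cochains *)

(** The hypothesis on gamma concerns Koszul cohomology of M itself, never of a quotient M_l. This is
    why classes of H^i_m(M_l) are lifted: adjoining gamma_1, ..., gamma_l to the powers of the
    variables trades M_l for M at the price of l cohomological degrees, and for M nonzero the longer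
    tuple still belongs to Z_M.

    No colimit is formed. A statement about local cohomology reads: after raising the exponents by
    the chain map [up], some cochain is a coboundary modulo P.

    The bound eps enters by counting. The obstruction to describing the kernel has degree i + 1; the
    obstruction to adjoining a further gamma to h of them has degree i + h + 2, while vanishing on h
    additional elements holds above eps + h. So i >= eps suffices for both.

    In the vanishing, the parameters generate m up to radical only after localizing at m. A factor s
    outside m is therefore carried along; it is removed at the end because it is invertible modulo
    the variables. *)

Section Koszul.
Variables (R : comNzRingType) (M : lmodType R).
Implicit Types (z w : seq R) (r : nat) (A P : submodClosed M).

(* The Koszul cochains on [r] elements: a pair [(a, b)] consists of the part [a] without and the
   part [b] with the first index. *)
Fixpoint kos r : lmodType R := if r is r'.+1 then (kos r' * kos r')%type else M.

Lemma kos_eq r (x y : kos r.+1) : x.1 = y.1 -> x.2 = y.2 -> x = y.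
Proof. by case: x y => [a b] [a' b'] /= -> ->. Qed.

(** Up to a shift, the complex on [u :: z] is the mapping cone of multiplication by [u] on the
    complex on [z], so that inductions can split off one element at a time. *)
Fixpoint kd z r : kos r -> kos r :=
  match r return kos r -> kos r with
  | 0 => fun=> 0
  | r'.+1 => fun c => (kd (behead z) c.1, head 0 z *: c.1 - kd (behead z) c.2)
  end.

Lemma kd_linear z r : linear (@kd z r).
Proof.
elim: r z => [|r IH] z a x y /=; first by rewrite scaler0 addr0.
apply: kos_eq; rewrite /= ?IH //.
by rewrite scalerDr !scalerBr !scalerA mulrC opprD addrACA.
Qed.
HB.instance Definition _ z r :=
  GRing.isLinear.Build R (kos r) (kos r) _ (@kd z r) (@kd_linear z r).

Lemma kdS z r (c : kos r.+1) :
  kd z c = (kd (behead z) c.1, head 0 z *: c.1 - kd (behead z) c.2).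
Proof. by []. Qed.

Lemma kdK z r (c : kos r) : kd z (kd z c) = 0.
Proof.
elim: r z c => [//|r IH] z c; rewrite kdS; apply: kos_eq; rewrite /= ?IH //.
by rewrite linearB linearZ /= IH subr0 subrr.
Qed.

(* The chain map K(z) -> K(z w): the entry at [S] is multiplied by the product of the [w_j], [j] in [S]. *)
Fixpoint up w r : kos r -> kos r :=
  match r return kos r -> kos r with
  | 0 => id
  | r'.+1 => fun c => (up (behead w) c.1, head 1 w *: up (behead w) c.2)
  end.

Lemma up_linear w r : linear (@up w r).
Proof.
elim: r w => [|r IH] w a x y //=.
by apply: kos_eq; rewrite /= IH // scalerDr !scalerA mulrC.
Qed.
HB.instance Definition _ w r :=
  GRing.isLinear.Build R (kos r) (kos r) _ (@up w r) (@up_linear w r).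

Lemma upS w r (c : kos r.+1) : up w c = (up (behead w) c.1, head 1 w *: up (behead w) c.2).
Proof. by []. Qed.

(** Missing entries of [w] count as 1, in agreement with the default [head 1 w] of [up]: multiplying
    by [pow K v] raises a prefix of powers and leaves the elements after it alone. *)
Fixpoint zmul z w : seq R :=
  match z, w with
  | u :: z', v :: w' => u * v :: zmul z' w'
  | _, _ => z
  end.

Lemma zmul_head z w : head 0 (zmul z w) = head 0 z * head 1 w.
Proof. by case: z w => [|u z] [|v w] //=; rewrite ?mul0r ?mulr1. Qed.
Lemma zmul_behead z w : behead (zmul z w) = zmul (behead z) (behead w).
Proof. by case: z w => [|u z] [|v w] //=; case: (z). Qed.

Lemma up_kd z w r (c : kos r) : kd (zmul z w) (up w c) = up w (kd z c).
Proof.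
elim: r z w c => [//|r IH] z w c.
rewrite kdS upS /= zmul_behead zmul_head; apply: kos_eq; rewrite /= ?IH //.
rewrite [in LHS]linearZ /= IH linearB [in RHS]linearZ /= scalerBr ?scalerN.
by rewrite !scalerA mulrC.
Qed.

(* The contracting homotopy showing that the [k]-th element kills Koszul cohomology. *)
Fixpoint homotopy k r : kos r -> kos r :=
  match r return kos r -> kos r with
  | 0 => fun=> 0
  | r'.+1 => fun c => if k is k'.+1 then (homotopy k' c.1, - homotopy k' c.2) else (c.2, 0)
  end.

Lemma homotopy_linear k r : linear (@homotopy k r).
Proof.
elim: r k => [|r IH] [|k] a x y /=; rewrite ?scaler0 ?addr0 //.
  by apply: kos_eq; rewrite /= ?scaler0 ?addr0.
by apply: kos_eq; rewrite /= IH // opprD scalerN.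
Qed.
HB.instance Definition _ k r :=
  GRing.isLinear.Build R (kos r) (kos r) _ (@homotopy k r) (@homotopy_linear k r).

Lemma homotopy_kd k z r (c : kos r) : (k < r)%N ->
  kd z (homotopy k c) + homotopy k (kd z c) = nth 0 z k *: c.
Proof.
elim: r k z c => [|r IH] [|k] z c //= kr; apply: kos_eq; rewrite /=.
- by rewrite addrC subrK; case: z.
- by rewrite linear0 subr0 addr0; case: z.
- by rewrite (IH k (behead z)) // nth_behead.
rewrite linearN linearB linearZ /= opprK opprB addrC addrA subrK addrC.
by rewrite IH // nth_behead.
Qed.

(* The cochains of cohomological degree [j] with values in [A]; integral degrees avoid a case
   distinction at [0]. *)
Fixpoint chain A r (j : int) : {pred kos r} :=
  match r return kos r -> bool with
  | 0 => fun a => if j == 0 then a \in A else a == 0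
  | r'.+1 => fun c => (c.1 \in @chain A r' j) && (c.2 \in @chain A r' (j - 1))
  end.

Arguments chain : clear implicits.

Lemma chainS A r j (c : kos r.+1) :
  (c \in chain A r.+1 j) = (c.1 \in chain A r j) && (c.2 \in chain A r (j - 1)).
Proof. by []. Qed.

Lemma chain0E A j (c : kos 0) :
  (c \in chain A 0 j) = if j == 0 then c \in A else c == 0.
Proof. by []. Qed.

Lemma chain_closed A r j : submod_closed (chain A r j).
Proof.
elim: r j => [|r IH] j; split=> [|a x y].
- by rewrite chain0E rpred0 eqxx if_same.
- rewrite !chain0E; case: ifP => _; first by move=> ? ?; rewrite rpredD ?rpredZ.
  by move=> /eqP-> /eqP->; rewrite scaler0 addr0.
- by rewrite chainS; apply/andP; split; apply: (IH _).1.
- rewrite !chainS /= => /andP[? ?] /andP[? ?]; apply/andP.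
  by split; apply: (IH _).2.
Qed.
HB.instance Definition _ A r j :=
  GRing.isSubmodClosed.Build R (kos r) (chain A r j) (chain_closed A r j).
Lemma chain_opp A r j : oppr_closed (chain A r j).
Proof. by move=> x xN; rewrite -scaleN1r rpredZ. Qed.
HB.instance Definition _ A r j :=
  GRing.isOppClosed.Build (kos r) (chain A r j) (@chain_opp A r j).

Lemma chain_kd A z r j (c : kos r) : c \in chain A r j -> kd z c \in chain A r (j + 1).
Proof.
elim: r z j c => [|r IH] z j c; first by move=> _; apply: rpred0.
rewrite !chainS /= => /andP[c1 c2]; rewrite IH //= rpredB //.
  by rewrite addrK rpredZ.
by rewrite addrAC IH.
Qed.

Lemma chain_up A w r j (c : kos r) : c \in chain A r j -> up w c \in chain A r j.
Proof.
elim: r w j c => [//|r IH] w j c; rewrite !chainS /= => /andP[c1 c2].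
by rewrite IH // rpredZ // IH.
Qed.

Lemma chain_homotopy A k r j (c : kos r) : c \in chain A r j -> homotopy k c \in chain A r (j - 1).
Proof.
elim: r k j c => [|r IH] [|k] j c; try by move=> _; apply: rpred0.
  by rewrite !chainS /= rpred0 andbT => /andP[].
by rewrite !chainS /= => /andP[c1 c2]; rewrite rpredN !IH.
Qed.

Lemma chain_sub A P r j (c : kos r) : {subset A <= P} ->
  c \in chain A r j -> c \in chain P r j.
Proof.
move=> AP; elim: r j c => [|r IH] j c.
  by rewrite !chain0E; case: ifP => // _; apply: AP.
by rewrite !chainS => /andP[/IH-> /IH->].
Qed.

Lemma chain_gt A r j (c : kos r) : r%:Z < j -> c \in chain A r j -> c = 0.
Proof.
elim: r j c => [|r IH] j c rj; first by rewrite chain0E; case: eqP => [|_ /eqP//]; lia.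
rewrite chainS => /andP[c1 c2]; apply: kos_eq.
  by apply: IH c1; lia.
by apply: IH c2; lia.
Qed.

Definition idl z (u : R) := exists f : nat -> R, u = \sum_(i < size z) f i * z`_i.

Lemma idl_mem z u : u \in z -> idl z u.
Proof.
move=> uz; exists (fun i => (i == index u z)%:R).
have iz : (index u z < size z)%N by rewrite index_mem.
rewrite (bigD1 (Ordinal iz)) //= eqxx mul1r nth_index // big1 ?addr0 // => i.
by rewrite -val_eqE /= => /negbTE->; rewrite mul0r.
Qed.
Lemma idl0 z : idl z 0.
Proof. by exists (fun=> 0); rewrite big1 // => i _; rewrite mul0r. Qed.
Lemma idlD z u v : idl z u -> idl z v -> idl z (u + v).
Proof.
move=> [f ->] [g ->]; exists (fun i => f i + g i).
by rewrite -big_split; apply: eq_bigr => i _; rewrite mulrDl.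
Qed.
Lemma idlM z a u : idl z u -> idl z (a * u).
Proof.
move=> [f ->]; exists (fun i => a * f i).
by rewrite mulr_sumr; apply: eq_bigr => i _; rewrite mulrA.
Qed.
Lemma idlB z u v : idl z u -> idl z v -> idl z (u - v).
Proof. by move=> zu zv; rewrite -mulN1r; apply/idlD/idlM. Qed.
Lemma idl_sub z z' u : {subset z <= z'} -> idl z u -> idl z' u.
Proof.
move=> zz' [f ->]; elim/big_rec: _ => [|i v _]; first exact: idl0.
by apply/idlD/idlM/idl_mem/zz'/mem_nth.
Qed.

(* Cocycles and coboundaries of K(z; A / P), on representatives in [A]. *)
Definition cyc A P z r j (c : kos r) :=
  c \in chain A r j /\ kd z c \in chain P r (j + 1).
Definition bdry A P z r j (c : kos r) :=
  exists2 b, b \in chain A r (j - 1) & c - kd z b \in chain P r j.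

Section Mod.
Variables (A P : submodClosed M).

Lemma bdryD z r j (c c' : kos r) : bdry A P z j c -> bdry A P z j c' -> bdry A P z j (c + c').
Proof.
move=> [b bA cb] [b' b'A cb']; exists (b + b'); first exact: rpredD.
by rewrite linearD opprD addrACA rpredD.
Qed.
Lemma bdryZ z r j a (c : kos r) : bdry A P z j c -> bdry A P z j (a *: c).
Proof.
move=> [b bA cb]; exists (a *: b); first exact: rpredZ.
by rewrite linearZ -scalerBr rpredZ.
Qed.
Lemma bdry_mod z r j (c : kos r) : c \in chain P r j -> bdry A P z j c.
Proof. by move=> cP; exists 0; rewrite ?rpred0 // linear0 subr0. Qed.
Lemma bdry_eqmod z r j (c c' : kos r) : c - c' \in chain P r j ->
  bdry A P z j c' -> bdry A P z j c.
Proof. by move=> /(bdry_mod z) h h'; rewrite -(subrK c' c); apply: bdryD. Qed.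
Lemma bdry_up w z r j (c : kos r) : bdry A P z j c -> bdry A P (zmul z w) j (up w c).
Proof.
move=> [b bA cb]; exists (up w b); first exact: chain_up.
by rewrite up_kd -linearB; apply: chain_up.
Qed.

Lemma cyc_up w z r j (c : kos r) : cyc A P z j c -> cyc A P (zmul z w) j (up w c).
Proof. by move=> [cA dc]; split; rewrite ?up_kd; apply: chain_up. Qed.
Lemma cycZ z r j a (c : kos r) : cyc A P z j c -> cyc A P z j (a *: c).
Proof. by move=> [cA dc]; split; rewrite ?linearZ rpredZ. Qed.

Lemma idl_kills z r j u (c : kos r) : (size z <= r)%N -> idl z u ->
  cyc A P z j c -> bdry A P z j (u *: c).
Proof.
move=> zr [f ->] [cA dc]; exists (\sum_(i < size z) f i *: homotopy i c).
  by apply: rpred_sum => i _; rewrite rpredZ // chain_homotopy.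
rewrite linear_sum scaler_suml -sumrB; apply: rpred_sum => i _.
rewrite linearZ /= -scalerA -scalerBr rpredZ //.
rewrite -(homotopy_kd z c (leq_trans (ltn_ord i) zr)) addrC addKr.
by have := chain_homotopy i dc; rewrite addrK.
Qed.

(** This and [bdry_cons] replace the long exact sequence of the cone: subtracting the coboundary of
    [(a1, 0)] removes [c.1] modulo [P], and what remains of [c] is the class of [c.2 - u *: a1], one
    degree lower. *)
Lemma cyc_cons u z r j (c : kos r.+1) a1 : cyc A P (u :: z) j c ->
  a1 \in chain A r (j - 1) -> c.1 - kd z a1 \in chain P r j ->
  cyc A P z (j - 1) (c.2 - u *: a1).
Proof.
case: c => a b [] /andP[/= aA bA] /andP[/= da db] a1A e; split.
  by rewrite rpredB ?rpredZ.
rewrite linearB linearZ /= -opprB rpredN subrK.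
have -> : u *: kd z a1 - kd z b = u *: a - kd z b - u *: (a - kd z a1).
  by rewrite scalerBr opprB [RHS]addrC addrA subrK.
by rewrite addrK in db; rewrite rpredB ?rpredZ.
Qed.

Lemma bdry_cons u z r j (c : kos r.+1) a1 :
  a1 \in chain A r (j - 1) -> c.1 - kd z a1 \in chain P r j ->
  bdry A P z (j - 1) (c.2 - u *: a1) -> bdry A P (u :: z) j c.
Proof.
case: c => a b /= a1A e [b1 b1A e1]; exists (a1, - b1).
  by rewrite chainS /= a1A rpredN.
by rewrite chainS /= e /= linearN opprK opprD addrA.
Qed.
End Mod.
End Koszul.
Arguments chain {R M} A r j.

Definition pow (R : comNzRingType) N (v : seq R) := [seq y ^+ N | y <- v].

(** * Vanishing of local cohomology *)

Section Vanishing.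
Variables (R : comNzRingType) (M : lmodType R).
Implicit Types (z w v : seq R) (r : nat).
Local Notation kos := (kos M).

Lemma size_pow N v : size (pow N v) = size v. Proof. exact: size_map. Qed.

Lemma zmul_pow N K v z : zmul (pow N v ++ z) (pow K v) = pow (N + K) v ++ z.
Proof. by elim: v => [|y v /= ->]; [case: z | rewrite exprD]. Qed.

Lemma up_comp w w' r (c : kos r) : size w = size w' ->
  up w (up w' c) = up (zmul w' w) c.
Proof.
elim: r w w' c => [//|r IH] w w' c e; rewrite !upS /= linearZ /=.
by rewrite !IH ?size_behead ?e // -zmul_behead scalerA; case: w w' e => [|a w] [|b w'] //=;
  rewrite ?mulr1 // mulrC.
Qed.

Lemma up_pow N K v r (c : kos r) : up (pow K v) (up (pow N v) c) = up (pow (N + K) v) c.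
Proof. by rewrite up_comp ?size_pow // -[pow N v]cats0 zmul_pow cats0. Qed.

Lemma exprD_split (a b : R) m n : exists x y, (a + b) ^+ (m + n) = x * a ^+ m + y * b ^+ n.
Proof.
elim: m n => [|m IHm] n; first by exists ((a + b) ^+ n), 0; rewrite mul0r addr0 mulr1.
elim: n => [|n [x [y e]]]; first by exists 0, ((a + b) ^+ (m.+1 + 0)); rewrite mul0r add0r mulr1.
have [x' [y' e']] := IHm n.+1.
exists (x' + b * x), (y' * a + y).
have -> : (a + b) ^+ (m.+1 + n.+1) = a * (a + b) ^+ (m + n.+1) + b * (a + b) ^+ (m.+1 + n).
  by rewrite addSn exprS mulrDl addSnnS.
rewrite e e' !exprS; ring.
Qed.

Lemma idl_pow v u N : idl v u -> exists K, idl (pow N v) (u ^+ K).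
Proof.
move=> [f ->]; elim: v f => [|y v IH] f.
  by exists 1%N; rewrite expr1 big_ord0; apply: idl0.
rewrite big_ord_recl /=; have [K hK] := IH (fun i => f i.+1).
exists (N + K)%N; set s := \sum_(_ < _) _ in hK *.
have [a [b ->]] := exprD_split (f 0%N * y) s N K; apply: idlD.
  by rewrite exprMn mulrA; apply/idlM/idl_mem/mem_head.
by apply/idlM; apply: idl_sub hK => x xv; rewrite inE xv orbT.
Qed.

Section Peel.
Variables (A P : submodClosed M).
Variable S : mulrClosed R.

(** Modulo [z] and after localization at [S], such a [rho] is a power of [y]. These elements are
    closed under products, so a single one serves all the finitely many entries of a cochain. *)
Definition local_power (y : R) z rho :=
  exists s K xi, [/\ s \in S, idl z xi & rho = s * y ^+ K - xi].

Lemma local_powerM y z rho rho' : local_power y z rho -> local_power y z rho' -> local_power y z (rho * rho').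
Proof.
move=> [s [K [xi [sS h ->]]]] [s' [K' [xi' [s'S h' ->]]]].
exists (s * s'), (K + K')%N, (s * y ^+ K * xi' + s' * y ^+ K' * xi - xi * xi').
split; [exact: rpredM| |by rewrite exprD; ring].
by apply: idlB; [apply: idlD|]; apply: idlM.
Qed.

Lemma local_power_chain y z r j (b : kos r) :
  (forall a, a \in A -> exists2 rho, local_power y z rho & rho *: a \in P) ->
  b \in chain A r j -> exists2 rho, local_power y z rho & rho *: b \in chain P r j.
Proof.
move=> h; elim: r j b => [|r IH] j b.
  rewrite chain0E; case: ifP => j0; first by move/h => [rho]; exists rho; rewrite // chain0E j0.
  move=> /eqP->; exists 1; last by rewrite scaler0 rpred0.
  by exists 1, 0%N, 0; split; [exact: rpred1|exact: idl0|rewrite mulr1 subr0].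
rewrite chainS => /andP[/IH[rho hr e] /IH[rho' hr' e']].
exists (rho * rho'); first exact: local_powerM.
rewrite chainS [rho * _]mulrC /= -scalerA rpredZ /=; last by []. by rewrite mulrC -scalerA rpredZ.
Qed.

(** Once all of [v] is peeled off, only the elements [xs] remain, and their complex is zero above
    degree [size xs]. When [y] is put back, the part without [y] has the same degree and bounds by
    induction. The other part may have too small a degree for the induction; it is killed by a power
    of [y], up to [S] and [xs], and [up] multiplies exactly this part by a power of [y]. *)
Lemma vanish_up_to_unit xs v : 
  (forall y, y \in v -> forall a, a \in A -> exists2 rho, local_power y xs rho & rho *: a \in P) ->
  forall q N j (c : kos q), q = (size v + size xs)%N -> (size xs)%:Z < j ->
  cyc A P (pow N v ++ xs) j c ->
  exists s K, s \in S /\ bdry A P (pow (N + K) v ++ xs) j (s *: up (pow K v) c).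
Proof.
elim: v => [|y v IH] hv q N j c eq js cc.
  subst q; exists 1, 0%N; split; first exact: rpred1.
  by rewrite scale1r (chain_gt js cc.1) linear0; apply/bdry_mod/rpred0.
case: q eq c cc => [//|q] [eq] c cc.
have hv' x : x \in v -> forall a, a \in A -> exists2 rho, local_power x xs rho & rho *: a \in P.
  by move=> xv; apply: hv; rewrite inE xv orbT.
have cc1 : cyc A P (pow N v ++ xs) j c.1.
  by case: cc => /andP[? _] /andP[].
have [s1 [K1 [s1S [a1 a1A e1]]]] := IH hv' _ N j c.1 eq js cc1.
pose c1 := s1 *: up (pow K1 (y :: v)) c.
have cc' : cyc A P (pow (N + K1) (y :: v) ++ xs) j c1.
  by rewrite -zmul_pow; apply/cycZ/cyc_up.
have /(local_power_chain (hv y (mem_head _ _)))[rho [s2 [K2 [xi [s2S xis ->]]]] h2] := (cyc_cons cc' a1A e1).1.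
exists (s2 * s1), (K1 + K2)%N; split; first exact: rpredM.
have -> : (s2 * s1) *: up (pow (K1 + K2) (y :: v)) c = s2 *: up (pow K2 (y :: v)) c1.
  by rewrite -scalerA -up_pow [in RHS]linearZ.
rewrite addnA.
apply: (@bdry_cons _ _ A P (y ^+ (N + K1 + K2)) (pow (N + K1 + K2) v ++ xs) q j _
  (s2 *: up (pow K2 v) a1)).
- by rewrite rpredZ // chain_up.
- rewrite -zmul_pow [kd _ _]linearZ /= up_kd -scalerBr -linearB rpredZ //.
  exact: chain_up.
have -> : (s2 *: up (pow K2 (y :: v)) c1).2 - y ^+ (N + K1 + K2) *: (s2 *: up (pow K2 v) a1) =
  up (pow K2 v) ((s2 * y ^+ K2) *: (c1.2 - y ^+ (N + K1) *: a1)).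
  rewrite [in RHS]linearZ [in RHS]linearB /= [up _ (_ *: a1)]linearZ /= scalerBr !scalerA.
  by congr (_ *: _ - _ *: _); rewrite !exprD; ring.
rewrite -zmul_pow; apply: bdry_up.
(* Modulo [P] the factor s2 y^K2 acts as [xi], which lies in the ideal of [xs] and so kills the
   cohomology of a complex that has [xs] among its elements. *)
apply: bdry_eqmod (_ : bdry A P _ _ (xi *: (c1.2 - y ^+ (N + K1) *: a1))).
  by rewrite -scalerBl.
apply: idl_kills (cyc_cons cc' a1A e1) => //.
  by rewrite size_cat size_pow eq.
by apply: idl_sub xis => x xs_x; rewrite mem_cat xs_x orbT.
Qed.
End Peel.

(* [app a b] extends the index set at the end: [a] and [b] are the parts without and with the new index. *)
Fixpoint app r : kos r -> kos r -> kos r.+1 :=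
  match r return kos r -> kos r -> kos r.+1 with
  | 0 => fun a b => (a, b)
  | r'.+1 => fun a b => (app a.1 b.1, app a.2 (- b.2))
  end.

Fixpoint res r : kos r.+1 -> kos r :=
  match r return kos r.+1 -> kos r with
  | 0 => fun c => c.1
  | r'.+1 => fun c => (res c.1, res c.2)
  end.

Lemma appB r (a b a' b' : kos r) : app a b - app a' b' = app (a - a') (b - b').
Proof.
elim: r a b a' b' => [//|r IH] a b a' b' /=; apply: (@kos_eq _ _ r.+1); rewrite /= IH //.
by rewrite opprB opprK; congr app; rewrite addrC.
Qed.
Lemma appZ r x (a b : kos r) : x *: app a b = app (x *: a) (x *: b).
Proof. by elim: r a b => [//|r IH] a b /=; apply: (@kos_eq _ _ r.+1); rewrite /= IH ?scalerN. Qed.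

Local Arguments kd : simpl never.

Lemma kd_app z u r (a b : kos r) : size z = r ->
  kd (rcons z u) (app a b) = app (kd z a) (u *: a - kd z b).
Proof.
elim: r z a b => [|r IH] [|y z] a b // zr.
case: zr => zr; rewrite ![kd (y :: z) _]kdS.
rewrite -[LHS]/(kd (rcons z u) (app a.1 b.1), y *: app a.1 b.1 - kd (rcons z u) (app a.2 (- b.2))).
rewrite !IH //=; congr (_, _).
rewrite appZ appB linearN opprK; congr app.
by rewrite opprB opprD addrCA [RHS]addrC.
Qed.

Lemma chain_app A r j (a b : kos r) : a \in chain A r j -> b \in chain A r (j - 1) ->
  app a b \in chain A r.+1 j.
Proof.
elim: r j a b => [|r IH] j a b; first by rewrite chainS => -> ->.
rewrite !chainS => /andP[a1 a2] /andP[b1 b2].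
by apply/andP; split; apply: IH; rewrite ?rpredN.
Qed.

Lemma res_app r (a b : kos r) : res (app a b) = a.
Proof. by elim: r a b => [//|r IH] a b /=; rewrite !IH; case: a. Qed.

Lemma res_linear r : linear (@res r).
Proof.
elim: r => [//|r IH] a x y; apply: kos_eq; exact: IH.
Qed.
HB.instance Definition _ r :=
  GRing.isLinear.Build R (kos r.+1) (kos r) _ (@res r) (@res_linear r).

Lemma res_kd z u r (c : kos r.+1) : size z = r -> res (kd (rcons z u) c) = kd z (res c).
Proof.
elim: r z c => [|r IH] [|y z] c // zr.
case: zr => zr; rewrite [kd (y :: z) _]kdS.
have -> : res (kd (rcons (y :: z) u) c) =
  (res (kd (rcons z u) (c.1 : kos r.+1)), res (y *: (c.1 : kos r.+1) - kd (rcons z u) (c.2 : kos r.+1))) by [].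
by rewrite linearB linearZ /= !IH.
Qed.

Lemma res_up w r (c : kos r.+1) : res (up w c) = up w (res c).
Proof.
elim: r w c => [//|r IH] w c; rewrite upS /= linearZ /=.
by rewrite !IH.
Qed.

Lemma chain_res A r j (c : kos r.+1) : c \in chain A r.+1 j -> res c \in chain A r j.
Proof.
elim: r j c => [|r IH] j c; first by rewrite chainS => /andP[].
by rewrite chainS => /andP[c1 c2]; rewrite chainS /= !IH.
Qed.

Fixpoint resn e r : kos (e + r) -> kos r :=
  match e return kos (e + r) -> kos r with
  | 0 => id
  | e'.+1 => fun c => resn (@res (e' + r) c)
  end.

Lemma resn_up w e r (c : kos (e + r)) : resn (up w c) = up w (resn c).
Proof. by elim: e c => [//|e IH] c; rewrite /= res_up IH. Qed.

Lemma resnZ a e r (c : kos (e + r)) : resn (a *: c) = a *: resn c.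
Proof. by elim: e c => [//|e IH] c /=; rewrite linearZ IH. Qed.

Section Lift.
Variables (A P : submodClosed M).

Lemma bdry_resn ys z r j (c : kos (size ys + r)) : size z = r ->
  bdry A P (z ++ rev ys) j c -> bdry A P z j (resn c).
Proof.
move=> zr; elim: ys c => [|y ys IH] c /=; first by rewrite cats0.
rewrite rev_cons -rcons_cat => -[b bA e]; apply: IH; exists (res b).
  exact: chain_res.
have <- : res (kd (rcons (z ++ rev ys) y) b) = kd (z ++ rev ys) (res b).
  by apply: res_kd; rewrite size_cat size_rev zr addnC.
by rewrite -linearB; apply: chain_res.
Qed.

(** A cocycle extends over a new element [y] as soon as [y] times it is a coboundary, and elements
    of the ideal of [z] kill the cohomology. *)
Lemma cyc_lift ys z r j (c : kos r) : size z = r -> (forall y, y \in ys -> idl z y) ->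
  cyc A P z j c -> exists2 c' : kos (size ys + r), cyc A P (z ++ rev ys) j c' & resn c' = c.
Proof.
move=> zr; elim: ys => [|y ys IH] hy cc; first by exists c; rewrite ?cats0.
have [|c' cc' e] := IH _ cc; first by move=> x xs; apply: hy; rewrite inE xs orbT.
have sz : size (z ++ rev ys) = (size ys + r)%N by rewrite size_cat size_rev zr addnC.
have [||b bA eb] := idl_kills (r := size ys + r) (u := y) _ _ cc'.
- by rewrite sz.
- apply: idl_sub (hy y (mem_head _ _)) => x; rewrite mem_cat => -> //.
exists (app c' b); last by rewrite /= res_app.
rewrite rev_cons -rcons_cat; split; first by apply: chain_app; [exact: cc'.1|].
by rewrite kd_app //; apply: chain_app; [exact: cc'.2|rewrite addrK].
Qed.
End Lift.

Lemma unif_idl_pow z xs : (forall x, x \in xs -> idl z x) ->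
  forall N, exists K, forall y, y \in pow K xs -> idl (pow N z) y.
Proof.
move=> h N; elim: xs h => [|x xs IH] h; first by exists 0%N.
have [|K hK] := IH; first by move=> y ys; apply: h; rewrite inE ys orbT.
have [L hL] := idl_pow N (h x (mem_head _ _)).
exists (L + K)%N => _ /mapP[y + ->]; rewrite inE => /orP[/eqP->|ys].
  by rewrite exprD mulrC; apply: idlM.
by rewrite exprD; apply/idlM/hK/map_f.
Qed.

Section Vanish.
Variables (A P : submodClosed M).
Variable S : mulrClosed R.
Variables v xs : seq R.
Hypothesis v_xs : forall x, x \in xs -> idl v x.
Hypothesis S_v : forall s, s \in S -> exists2 s', s' \in S & idl v (1 - s' * s).
Hypothesis xs_v : forall N y, y \in v -> forall a, a \in A ->
  exists2 rho, local_power S y (pow N xs) rho & rho *: a \in P.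

(* Independence of the radical: a class over [v] lifts to one over [v] and powers of [xs],
   and over [xs] alone there is nothing above degree [size xs]. *)
Lemma vanish N j (c : kos (size v)) : (size xs)%:Z < j -> cyc A P (pow N v) j c ->
  exists K, bdry A P (pow (N + K) v) j (up (pow K v) c).
Proof.
move=> js cc; have [N1 hN1] := unif_idl_pow v_xs N.
have [|y|c' cc' e] := cyc_lift (ys := rev (pow N1 xs)) _ _ cc; rewrite ?size_pow //.
  by rewrite mem_rev => /hN1.
rewrite revK in cc'.
have [||s [K [sS b]]] := vanish_up_to_unit (@xs_v N1) _ _ cc'.
- by rewrite size_rev addnC.
- by rewrite size_pow.
exists K; have {b} : bdry A P (pow (N + K) v) j (s *: up (pow K v) c).
  rewrite -e -resn_up -resnZ.
  by apply: bdry_resn; rewrite ?size_pow // revK.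
have [s' s'S h] := S_v sS; have [L [f eL]] := idl_pow (N + K) h.
set cK := up _ c => b.
have {b} b : bdry A P (pow (N + K) v) j ((s' * s) *: cK) by rewrite -scalerA; apply: bdryZ.
(* A finite geometric series inverts s' s up to (1 - s' s)^L, and this power lies in the ideal of
   the current powers of [v], hence kills the class. *)
have -> : cK = (\sum_(i < L) (1 - s' * s) ^+ i) *: ((s' * s) *: cK) + (1 - s' * s) ^+ L *: cK.
  rewrite scalerA -scalerDl -[LHS]scale1r; congr (_ *: _).
  have -> : (1 - s' * s) ^+ L = 1 + (1 - s' * s - 1) * \sum_(i < L) (1 - s' * s) ^+ i.
    by rewrite -subrX1 addrCA subrr addr0.
  ring.
apply: bdryD; first exact: bdryZ.
apply: idl_kills; rewrite ?size_pow //; first by rewrite eL; exists f; rewrite ?size_pow.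
by rewrite -[pow N v]cats0 in cc; have := cyc_up (pow K v) cc; rewrite zmul_pow cats0.
Qed.
End Vanish.
End Vanishing.

(** * Descent along a partial system of parameters *)

Section Colon.
Variables (R : comNzRingType) (M : lmodType R).

Definition colon (P : {pred M}) (g : R) : {pred M} := fun a => g *: a \in P.
Lemma colonE (P : {pred M}) g a : (a \in colon P g) = (g *: a \in P).
Proof. by []. Qed.
Lemma colon_closed (P : submodClosed M) g : submod_closed (colon P g).
Proof.
split=> [|a x y]; rewrite !colonE ?scaler0 ?rpred0 // => hx hy.
by rewrite scalerDr !scalerA mulrC -scalerA rpredD // rpredZ.
Qed.
HB.instance Definition _ (P : submodClosed M) g :=
  GRing.isSubmodClosed.Build R M (colon P g) (colon_closed P g).

Definition full : {pred M} := fun=> true.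
Lemma full_closed : submod_closed full. Proof. by []. Qed.
HB.instance Definition _ := GRing.isSubmodClosed.Build R M full full_closed.

Lemma chain_full (A : submodClosed M) r j (c : kos M r) :
  c \in chain A r j -> c \in chain full r j.
Proof. exact: chain_sub. Qed.

Lemma chain_colon (P : submodClosed M) g r j (c : kos M r) :
  c \in chain full r j -> g *: c \in chain P r j -> c \in chain (colon P g) r j.
Proof.
elim: r j c => [|r IH] j c; first by rewrite !chain0E; case: ifP.
rewrite !chainS => /andP[/IH h1 /IH h2] /andP[/= p1 p2].
by rewrite h1 ?h2.
Qed.

Lemma colon_chain (P : submodClosed M) g r j (c : kos M r) :
  c \in chain (colon P g) r j -> g *: c \in chain P r j.
Proof.
elim: r j c => [|r IH] j c.
  by rewrite !chain0E; case: ifP => // _ /eqP->; rewrite scaler0.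
by rewrite !chainS => /andP[/IH h1 /IH h2] /=; apply/andP.
Qed.

Lemma chain_split (P P' : submodClosed M) g r j (c : kos M r) :
  (forall x, x \in P' -> exists2 p, p \in P & exists y, x = p + g *: y) ->
  c \in chain P' r j -> exists p y, [/\ p \in chain P r j, y \in chain full r j & c = p + g *: y].
Proof.
move=> h; elim: r j c => [|r IH] j c.
  rewrite chain0E; case: eqP => [-> /h[p pP [y ->]]|j0 /eqP->]; first by exists p, y.
  by exists 0, 0; rewrite scaler0 addr0 !rpred0.
case: c => a b /andP[/= /IH[p1 [y1 [? ? ->]]] /IH[p2 [y2 [? ? ->]]]].
by exists (p1, p2), (y1, y2); split=> //; apply/andP.
Qed.
End Colon.
Arguments full {R M}.

Lemma up_pow0 (R : comNzRingType) (M : lmodType R) v r (c : kos M r) : up (pow 0 v) c = c.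
Proof.
elim: r v c => [//|r IH] v c; rewrite upS; apply: kos_eq; rewrite [LHS]/=.
  by case: v => [|y v]; rewrite ?(IH [::]) ?IH.
by case: v => [|y v]; rewrite /= ?(IH [::]) ?IH ?expr0 scale1r.
Qed.

Section Descent.
Variables (R : comNzRingType) (M : lmodType R) (v : seq R).
Implicit Types (A P : submodClosed M).

(** The first [h] elements, in the applications some of the gamma, keep their exponents while the
    powers of [v] are raised. *)
Definition weights h K := nseq h (1 : R) ++ pow K v.

Lemma zmul_weights ws N K : zmul (ws ++ pow N v) (weights (size ws) K) = ws ++ pow (N + K) v.
Proof.
rewrite /weights; elim: ws => [|w ws /= ->]; last by rewrite mulr1.
by rewrite -[pow N v]cats0 zmul_pow cats0.
Qed.

Lemma up_weights h N K r (c : kos M r) : up (weights h K) (up (weights h N) c) = up (weights h (N + K)) c.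
Proof.
have <- : zmul (weights h N) (weights h K) = weights h (N + K).
  by rewrite /weights; elim: h => [|h /= ->]; rewrite ?mulr1 // -[pow N v]cats0 zmul_pow cats0.
by rewrite up_comp // !size_cat !size_nseq !size_pow.
Qed.

(* The local cohomology of [A / P] vanishes above degree [e]. *)
Definition vanishing_above A P (e : int) := forall N j (c : kos M (size v)), e < j ->
  cyc A P (pow N v) j c -> exists K, bdry A P (pow (N + K) v) j (up (pow K v) c).

(** By the cone description each extra element raises the bound for vanishing by at most one. *)
Lemma vanishing_above_prefix A P e ws N j (c : kos M (size ws + size v)) : vanishing_above A P e ->
  e + (size ws)%:Z < j -> cyc A P (ws ++ pow N v) j c ->
  exists K, bdry A P (ws ++ pow (N + K) v) j (up (weights (size ws) K) c).
Proof.
move=> van; elim: ws N j c => [|w ws IH] N j c ej cc.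
  by apply: van cc; rewrite addr0 in ej.
have cc1 : cyc A P (ws ++ pow N v) j c.1.
  by case: cc => /andP[? _] /andP[].
have [|K1 [a1 a1A e1]] := IH _ _ _ _ cc1; first by move: ej; rewrite /=; lia.
pose c1 := up (weights (size ws).+1 K1) c.
have cc' : cyc A P (w :: (ws ++ pow (N + K1) v)) j c1.
  by have := cyc_up (weights (size ws).+1 K1) cc; rewrite (zmul_weights (w :: ws)).
have cb := cyc_cons cc' a1A e1.
have [|K2 b2] := IH _ _ _ _ cb; first by move: ej; rewrite /=; lia.
exists (K1 + K2)%N; rewrite -up_weights addnA.
apply: (@bdry_cons _ _ A P w (ws ++ pow (N + K1 + K2) v) _ j _ (up (weights (size ws) K2) a1)).
- exact: chain_up.
- rewrite -zmul_weights up_kd.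
  have <- : up (weights (size ws) K2) c1.1 = (up (weights (size ws).+1 K2) c1).1 by [].
  by rewrite -linearB; apply: chain_up.
have <- // : up (weights (size ws) K2) (c1.2 - w *: a1) =
  (up (weights (size ws).+1 K2) c1).2 - w *: up (weights (size ws) K2) a1.
have -> : (up (weights (size ws).+1 K2) c1).2 = 1 *: up (weights (size ws) K2) c1.2 by [].
by rewrite scale1r linearB; congr (_ - _); rewrite linearZ.
Qed.

Fixpoint top h r : kos M (h + r) -> kos M r :=
  match h return kos M (h + r) -> kos M r with
  | 0 => id
  | h'.+1 => fun c => top (c.2 : kos M (h' + r))
  end.

Lemma top_linear h r : linear (@top h r).
Proof. by elim: h => [//|h IH] a x y; apply: IH. Qed.
HB.instance Definition _ h r :=
  GRing.isLinear.Build R (kos M (h + r)) (kos M r) _ (@top h r) (@top_linear h r).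

Lemma top_up h K r (c : kos M (h + r)) : top (up (weights h K) c) = up (pow K v) (top c).
Proof.
by elim: h c => [//|h IH] c; rewrite /= scale1r IH.
Qed.

Lemma chain_top A h r j (c : kos M (h + r)) : c \in chain A (h + r) j ->
  top c \in chain A r (j - h%:Z).
Proof.
elim: h j c => [|h IH] j c; first by rewrite subr0.
by rewrite chainS => /andP[_ /IH]; rewrite -addrA -opprD -intS.
Qed.

(** Every other contribution to the top component carries a factor from [ws] and so has values in
    [P]. The sign comes from moving the differential past [h] indices. *)
Lemma top_kd (P : submodClosed M) ws h r z j (c : kos M (h + r)) : size ws = h ->
  (forall w x, w \in ws -> w *: x \in P) -> c \in chain full (h + r) j ->
  top (kd (ws ++ z) c) - (-1) ^+ h *: kd z (top c) \in chain P r (j + 1 - h%:Z).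
Proof.
move=> sh; subst h; move=> hws; elim: ws hws j c => [|w ws IH] hws j c.
  by move=> _; rewrite /= scale1r subrr rpred0.
move=> /andP[c1 c2] /=; rewrite linearB linearZ /= exprS mulN1r scaleNr opprK addrAC -addrA.
apply: rpredD.
  have hw : forall x, w *: x \in P by move=> x; apply/hws/mem_head.
  have := chain_top c1; move: (top _) => y.
  have -> : j + 1 - (size ws).+1%:Z = j - (size ws)%:Z by lia.
  elim: (r) (j - _) y => [|r' IH'] i y; first by rewrite !chain0E; case: ifP => // _ /eqP->; rewrite scaler0.
  by rewrite !chainS => /andP[/IH' ? /IH' ?]; apply/andP.
have -> : j + 1 - (size ws).+1%:Z = j - 1 + 1 - (size ws)%:Z by lia.
rewrite -opprB rpredN; apply: IH c2.
by move=> x y xs; apply: hws; rewrite inE xs orbT.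
Qed.

Variables (P : nat -> submodClosed M) (g : nat -> R) (t : nat) (e : int).
Hypothesis P_split : forall q x, x \in P q.+1 -> exists2 p, p \in P q & exists y, x = p + g q *: y.
Hypothesis P_killed : forall q, (q < t)%N -> vanishing_above (colon (P q) (g q)) (P q) e.

(* The kernel of H^i(M / P_l) -> H^i(M / P_(l+1)) is [g_l] H^i(M / P_l): multiplication by [g_l]
   factors through g_l (M / P_l), and the obstruction lies in H^(i+1) of the colon module. *)
Lemma kernel_cycle l N (i : int) (m b : kos M (size v)) : (l < t)%N -> e <= i ->
  cyc full (P l) (pow N v) i m -> b \in chain full _ (i - 1) ->
  m - kd (pow N v) b \in chain (P l.+1) _ i ->
  exists K c b', [/\ cyc full (P l) (pow (N + K) v) i c, b' \in chain full _ (i - 1)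
    & up (pow K v) m - kd (pow (N + K) v) b' - g l *: c \in chain (P l) _ i].
Proof.
move=> lt ei [mA dm] bA /(chain_split (@P_split l))[p [c0 [pP c0A e0]]].
(* The quotient [c0] of [m] by g_l need not be a cocycle modulo P_l, but g_l times its coboundary is
   in P_l. This coboundary is thus a cocycle of the colon module in degree i + 1 > e; after raising
   exponents it is bounded there by some [a], and [c0 - a] is the required cocycle. Subtracting [a]
   is harmless since g_l [a] has values in P_l. *)
have dc0 : kd (pow N v) c0 \in chain (colon (P l) (g l)) _ (i + 1).
  apply: chain_colon; first exact: chain_kd.
  have -> : g l *: kd (pow N v) c0 = kd (pow N v) m - kd (pow N v) p.
    have -> : m = p + g l *: c0 + kd (pow N v) b by rewrite -e0 subrK.
    by rewrite !linearD linearZ /= kdK addr0 addrC addrA addNr add0r.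
  by rewrite rpredB // chain_kd.
have [||K [a aA ea]] := P_killed lt (N := N) (j := i + 1) (c := kd (pow N v) c0); first lia.
  by split; rewrite // kdK rpred0.
rewrite addrK in aA.
exists K, (up (pow K v) c0 - a), (up (pow K v) b); split; last 1 first.
- have -> : up (pow K v) m = up (pow K v) p + g l *: up (pow K v) c0 + up (pow K v) (kd (pow N v) b).
    by rewrite -linearZ -!linearD /= -e0 subrK.
  have zp : zmul (pow N v) (pow K v) = pow (N + K) v by have := zmul_pow N K v [::]; rewrite !cats0.
  rewrite -zp up_kd addrK scalerBr opprB addrACA subrr addr0.
  by apply: rpredD; [exact: chain_up|exact: colon_chain].
- have zp : zmul (pow N v) (pow K v) = pow (N + K) v by have := zmul_pow N K v [::]; rewrite !cats0.
  split; first by rewrite rpredB ?(chain_full aA) // chain_up.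
  by rewrite linearB /= -zp up_kd zp.
by rewrite chain_up.
Qed.

Definition segment p h := [seq g i | i <- iota p h].
Lemma size_segment p h : size (segment p h) = h. Proof. by rewrite size_map size_iota. Qed.

(* Every class of H^i(M / P_q) comes from H^(i+q)(g_0, ..., g_(q-1), X^N; M); the obstruction to
   adjoining one [g] at a time lies in the cohomology of a colon module, in a degree where it vanishes. *)
Lemma lift_cycle q N (i : int) (c : kos M (size v)) h p : (p + h = q)%N -> (q <= t)%N -> e <= i ->
  cyc full (P q) (pow N v) i c ->
  exists K, exists2 c0 : kos M (h + size v),
    cyc full (P p) (segment p h ++ pow (N + K) v) (i + h%:Z) c0 & top c0 = up (pow K v) c.
Proof.
move=> + qt ei cc; elim: h p => [|h IH] p pq.
  rewrite addn0 in pq; subst p; exists 0%N; exists c; first by rewrite addr0 addn0.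
  by rewrite up_pow0.
have [|K [cq [cqA dcq] tq]] := IH p.+1; first by rewrite addSnnS.
have [pp [a [ppP aA ea]]] := chain_split (@P_split p) dcq.
set z' := segment p.+1 h ++ _ in dcq ea.
(* The pair [(a, cq)] would be a cocycle modulo P_p for the sequence with g_p in front, except that
   the coboundary of [a] lies only in the colon module. It bounds there, and [a] is corrected by the
   bounding cochain. *)
have da : kd z' a \in chain (colon (P p) (g p)) _ (i + h%:Z + 1 + 1).
  apply: chain_colon; first exact: chain_kd.
  have -> : g p *: kd z' a = - kd z' pp.
    apply/eqP; rewrite -addr_eq0; apply/eqP.
    by rewrite -[LHS]addrC -linearZ -linearD /= -ea kdK.
  by rewrite rpredN chain_kd.
have pt : (p < t)%N by lia.
have sz := size_segment p.+1 h.
have := @vanishing_above_prefix _ _ e (segment p.+1 h) (N + K)%N (i + h%:Z + 1 + 1).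
rewrite sz => /(_ _ _ (kd z' a) (P_killed pt)) [||K2 [a' a'A ea']]; first lia.
  by split; rewrite // kdK rpred0.
have zz : zmul z' (weights h K2) = segment p.+1 h ++ pow (N + (K + K2)) v.
  by rewrite -[in weights _ _]sz zmul_weights addnA.
rewrite -addnA -zz in ea'.
rewrite addrK in a'A.
exists (K + K2)%N, ((up (weights h K2) a - a', up (weights h K2) cq) : kos M (h.+1 + size v)); last first.
  by rewrite /= top_up tq up_pow.
have ih : i + h.+1%:Z = i + h%:Z + 1 by lia.
rewrite ih; split; rewrite (@chainS _ _ _ (h + size v)) ?kdS; apply/andP; split; rewrite /=.
- by rewrite rpredB ?(chain_full a'A) // chain_up.
- by rewrite addrK chain_up.
- by rewrite -zz linearB /= up_kd.
rewrite -zz up_kd ea addrK scalerBr [up _ (_ + _)]linearD /= [up _ (_ *: a)]linearZ /=.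
rewrite opprD [- up _ _ - _]addrC addrACA subrr add0r -opprD rpredN.
by rewrite rpredD ?chain_up // colon_chain.
Qed.
End Descent.

(** * Prime ideals and Kronecker's theorem *)

Section Primes.
Variable R : comNzRingType.
Implicit Types (I J : R -> Prop) (p q m : prime_idealr R).

Definition ideal I :=
  [/\ I 0, forall x y, I x -> I y -> I (x + y) & forall a x, I x -> I (a * x)].

Lemma ideal_adjoin I u : ideal I -> ideal (fun x => exists i a, I i /\ x = i + a * u).
Proof.
move=> [I0 ID IM]; split=> [|_ _ [i [a [Ii ->]]] [j [b [Ij ->]]]|c _ [i [a [Ii ->]]]].
- by exists 0, 0; rewrite mul0r addr0.
- by exists (i + j), (a + b); split; [exact: ID | ring].
- by exists (c * i), (c * a); split; [exact: IM | ring].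
Qed.

Lemma ideal_idl I z : ideal I -> ideal (fun x => exists i u, [/\ I i, idl z u & x = i + u]).
Proof.
move=> [I0 ID IM]; split=> [|_ _ [i [a [Ii za ->]]] [j [b [Ij zb ->]]]|c _ [i [a [Ii za ->]]]].
- by exists 0, 0; split; rewrite ?addr0 //; apply: idl0.
- by exists (i + j), (a + b); split; [exact: ID|exact: idlD|rewrite addrACA].
- by exists (c * i), (c * a); split; [exact: IM|exact: idlM|rewrite mulrDr].
Qed.

(** Zorn's lemma: an ideal maximal among those that contain [I] and miss the multiplicative set [S]
    is prime. *)
Lemma prime_avoiding I (S : R -> Prop) : ideal I -> S 1 ->
  (forall x y, S x -> S y -> S (x * y)) -> (forall x, I x -> ~ S x) ->
  exists2 p : prime_idealr R, forall x, I x -> x \in p & forall x, S x -> x \notin p.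
Proof.
move=> idI S1 SM IS.
pose T := {J : R -> Prop | [/\ ideal J, forall x, I x -> J x & forall x, J x -> ~ S x]}.
pose t0 : T := exist _ I (And3 idI (fun x h => h) IS).
pose le (J J' : T) := `[< forall x, sval J x -> sval J' x >].
have [||A tot|[J [idJ IJ JS]] Jmax] := @classical_sets.ZL_preorder T t0 le.
- by move=> J; apply/asboolP.
- by move=> J J' J'' /asboolP h /asboolP h'; apply/asboolP => x /h /h'.
- have [[J0 AJ0]|nA] := pselect (exists J : T, A J); last first.
    by exists t0 => J AJ; case: nA; exists J.
  pose U x := exists2 J : T, A J & sval J x.
  have hU : [/\ ideal U, forall x, I x -> U x & forall x, U x -> ~ S x].
    split; first split.
    + by exists J0 => //; case: (svalP J0) => -[].
    + move=> x y [J AJ Jx] [J' AJ' Jy].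
      by case: (tot _ _ AJ AJ') => /asboolP s; [exists J' | exists J] => //;
        [case: (svalP J') => -[_ h _] _ _ | case: (svalP J) => -[_ h _] _ _];
        apply: h => //; apply: s.
    + by move=> a x [J AJ Jx]; exists J => //; case: (svalP J) => -[_ _ h] _ _; apply: h.
    + by move=> x Ix; exists J0 => //; case: (svalP J0) => _ h _; apply: h.
    + by move=> x [J _ Jx]; case: (svalP J) => _ _ h; apply: h.
  by exists (exist _ U hU) => J AJ; apply/asboolP => x Jx; exists J.
have grow u : ~ J u -> exists s i a, [/\ S s, J i & s = i + a * u].
  move=> nJu; apply: contrapT => h.
  pose K x := exists i a, J i /\ x = i + a * u.
  have hK : [/\ ideal K, forall x, I x -> K x & forall x, K x -> ~ S x].
    split; first exact: ideal_adjoin.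
      by move=> x /IJ Jx; exists x, 0; rewrite mul0r addr0.
    by move=> x [i [a [Ji e]]] Sx; apply: h; exists x, i, a.
  have /asboolP/(_ u) : le (exist _ K hK) (exist _ J (And3 idJ IJ JS)).
    by apply: Jmax; apply/asboolP => x Jx; exists x, 0; rewrite mul0r addr0.
  by move=> Ku; apply/nJu/Ku; exists 0, 1; rewrite mul1r add0r; have [] := idJ.
pose q : {pred R} := fun x => `[< J x >].
have qE x : x \in q <-> J x by split => [/asboolP|/asboolP].
have q_ideal : idealr_closed q.
  split; first by apply/qE; have [] := idJ.
    by apply/negP => /qE /JS.
  by move=> a x y /qE Jx /qE Jy; apply/qE; have [_ h h'] := idJ; apply/h/Jy/h'.
have q_prime : prime_idealr_closed q.
  move=> u v /qE Juv; apply: contraT; rewrite negb_or => /andP[/negP nu /negP nv].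
  have [|s [i [a [Ss Ji es]]]] := grow u; first by move/qE.
  have [|s' [j [b [Ss' Jj es']]]] := grow v; first by move/qE.
  case: (JS _ _ (SM _ _ Ss Ss')); rewrite es es'; have [_ JD JM] := idJ.
  have -> : (i + a * u) * (j + b * v) = (j + b * v) * i + (a * u * j + a * b * (u * v)) by ring.
  by apply: (JD); [exact: JM|apply: (JD); exact: JM].
pose Q : prime_idealr R := HB.pack q (isIdealr.Build R q q_ideal)
  (isPrimeIdealrClosed.Build R q q_prime).
by exists Q => x; [move=> /IJ /qE | move=> Sx; apply/negP => /qE /JS].
Qed.

(** If no product s a^k with s outside [m] were in [I], a prime over [I] avoiding all of them would
    lie in [m] and omit [a]. *)
Lemma radical_local m I a : ideal I ->
  (forall p, (forall x, I x -> x \in p) -> {subset p <= m} -> a \in p) ->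
  exists s k, s \notin m /\ I (s * a ^+ k).
Proof.
move=> idI h; apply: contrapT => nh.
pose S x := exists s k, s \notin m /\ x = s * a ^+ k.
have S_ s : s \notin m -> S s by exists s, 0%N; rewrite mulr1.
have m1 : 1 \notin m by rewrite idealr1.
have [|x Ix [s [k [sm e]]]|p Ip pS] := @prime_avoiding I S idI (S_ _ m1).
- move=> _ _ [s [k [sm ->]]] [s' [k' [s'm ->]]]; exists (s * s'), (k + k')%N.
  by rewrite prime_idealrM negb_or sm s'm exprD; split=> //; ring.
- by apply: nh; exists s, k; rewrite -e.
have /negP[] : a \notin p by apply: pS; exists 1, 1%N; rewrite mul1r.
apply: h Ip _ => x; apply: contraTT => xm; exact/pS/S_.
Qed.

Lemma radical I a : ideal I -> (forall p, (forall x, I x -> x \in p) -> a \in p) ->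
  exists k, I (a ^+ k).
Proof.
move=> idI h; apply: contrapT => nh.
have [||x Ix [k ek]|p Ip pS] := @prime_avoiding I (fun x => exists k, x = a ^+ k) idI.
- by exists 0%N.
- by move=> _ _ [k ->] [k' ->]; exists (k + k')%N; rewrite exprD.
- by apply: nh; exists k; rewrite -ek.
by have /negP[] : a \notin p; [apply: pS; exists 1%N|apply: h].
Qed.

Section Kronecker.
Variable m : prime_idealr R.

(** The points other than the closed one in the spectrum of R / I localized at [m]. A bound [e] on
    the lengths of chains here corresponds to dimension at most [e] of that local ring. *)
Definition punctured I p :=
  [/\ forall x, I x -> x \in p, {subset p <= m} & ~ {subset m <= p}].

Definition punctured_chain I L (c : nat -> prime_idealr R) :=
  (forall i, (i < L)%N -> punctured I (c i)) /\
  forall i j, (i < j < L)%N -> {subset c i <= c j} /\ ~ {subset c j <= c i}.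

(* Coquand's proof of Kronecker's theorem: pass to the boundary of [b0], the ideal generated by
   [b0] and the elements whose product with [b0] lies in every prime of the punctured spectrum;
   it lowers the dimension, because a prime over it is not minimal. *)
Lemma kronecker e I a b : ideal I ->
  (forall L c, punctured_chain I L c -> (L <= e)%N) -> a \in m -> size b = e ->
  exists b', [/\ size b' = e, {subset b <= m} -> {subset b' <= m},
    forall p, a \in p -> {subset b' <= p} -> {subset b <= p}
  & forall p, (forall x, I x -> x \in p) -> {subset p <= m} -> {subset b' <= p} -> a \in p].
Proof.
move=> + + am; elim: e I b => [|e IH] I b idI bd.
  move=> /size0nil->; exists [::]; split=> // p Ip pm _.
  have [mp|nmp] := pselect {subset m <= p}; first exact: mp.
  suff /bd : punctured_chain I 1 (fun=> p) by [].
  by split=> [i _|i j /andP[ij /ltnSE]]; [split | rewrite leqn0 => /eqP ej; rewrite ej in ij].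
case: b => [//|b0 b] [sb].
pose W w := forall p, punctured I p -> w * b0 \in p.
have idW : ideal W.
  split=> [p _|x y Wx Wy p Up|c x Wx p Up]; first by rewrite mul0r rpred0.
    by rewrite mulrDl rpredD ?Wx ?Wy.
  by rewrite -mulrA idealMr ?Wx.
have idI' := ideal_adjoin b0 idW; set I' := fun x => _ in idI'.
have [|b' [sb' b'm bb' hb']] := IH I' b idI' _ sb.
- move=> [//|L] c [cU cs].
  have [Ic cm mc] := cU 0%N erefl.
  have b0c : b0 \in c 0%N by apply: Ic; exists 0, 1; rewrite mul1r add0r; case: idW.
  (* A prime avoiding these products lies below [c 0] and omits [b0], so it lengthens the chain by
     one. They avoid [I]: if s b0^k is in [I], then s b0 is in every punctured prime, so that s is
     in [W] and therefore in [c 0]. *)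
  pose S x := exists s k, s \notin c 0%N /\ x = s * b0 ^+ k.
  have Sin s : s \notin c 0%N -> S s by exists s, 0%N; rewrite mulr1.
  have [|||q Iq qS] := @prime_avoiding I S idI.
  + by apply: Sin; rewrite idealr1.
  + move=> _ _ [s [k [sm ->]]] [s' [k' [s'm ->]]]; exists (s * s'), (k + k')%N.
    by rewrite prime_idealrM negb_or sm s'm exprD; split=> //; ring.
  + move=> x Ix [s [k [/negP sc ex]]]; apply: sc; apply: Ic; exists s, 0; split; last by rewrite mul0r addr0.
    move=> p [Ip _ _]; have := Ip _ Ix; rewrite ex; elim: k {ex} => [|k IHk].
      by rewrite mulr1 => sp; rewrite mulrC idealMr.
    by rewrite exprSr mulrA prime_idealrM => /orP[//|b0p]; rewrite idealMr.
  have qc : {subset q <= c 0%N} by move=> x; apply: contraTT => xc; exact/qS/Sin.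
  have b0q : b0 \notin q by apply: qS; exists 1, 1%N; rewrite idealr1 mul1r.
  have c0 i : (i < L.+1)%N -> {subset c 0%N <= c i}.
    by case: i => [|i] iL //; have [] := cs 0%N i.+1 iL.
  apply: (bd L.+2 (fun i => if i is i'.+1 then c i' else q)); split.
    move=> [|i] iL; last first.
      have [Ii im mi] := cU i iL; split=> // x Ix; apply: Ii; exists x, 0; split; last by rewrite mul0r addr0.
      by move=> p [Ip _ _]; rewrite mulrC idealMr // Ip.
    by split=> // [x /qc /cm //|mq]; apply: mc => x /mq /qc.
  move=> [|i] [|j] //= => [ij|]; last exact: cs.
  split=> [x /qc /(c0 j)|jq]; first by apply.
  by move/negP: b0q; apply; apply/jq/c0.
have [|s [k [sm [_ [u [[w [r [Ww ->]]] zu e1]]]]]] := radical_local (m := m) (a := a) (ideal_idl b' idI').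
  move=> p hp pm; apply: hb' => //.
    move=> x I'x; apply: hp; exists x, 0; rewrite addr0; split=> //; exact: idl0.
  move=> x xb'; apply: hp; exists 0, x; rewrite add0r; split=> //; last exact: idl_mem.
  by case: idI'.
(* Here s a^k = w + r b0 + u with w b0 in every punctured prime and u in the ideal of [b']. A
   punctured prime containing b0 + a w and [b'] contains w or b0. If it contains w, it contains b0
   and then s a^k; if it contains b0, it contains a w. Either way it contains [a]. *)
exists ((b0 + a * w) :: b'); split=> [|bm x|p ap pb' x|p Ip pm pb']; first by rewrite /= sb'.
  rewrite inE => /orP[/eqP->|]; last by apply: b'm => y yb; apply: bm; rewrite inE yb orbT.
  by apply: rpredD; [exact/bm/mem_head|rewrite mulrC idealMr].
  rewrite inE => /orP[/eqP->|xb].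
    rewrite -(addrK (a * w) b0); apply: rpredB; first exact/pb'/mem_head.
    by rewrite mulrC idealMr.
  by apply: bb' xb => // y yb; apply: pb'; rewrite inE yb orbT.
have p0 : b0 + a * w \in p by apply/pb'/mem_head.
have pb'' : {subset b' <= p} by move=> y yb; apply: pb'; rewrite inE yb orbT.
have [mp|nmp] := pselect {subset m <= p}; first exact: mp.
have u_p : u \in p.
  by case: zu => f ->; apply: rpred_sum => i _; rewrite idealMr // pb'' // mem_nth.
have := Ww p (And3 Ip pm nmp); rewrite prime_idealrM => wb.
have wb0 : w \in p -> a \in p.
  move=> wp; have b0p : b0 \in p by rewrite -(addrK (a * w) b0) rpredB // idealMr.
  have : s * a ^+ k \in p by rewrite e1 !rpredD // idealMr.
  rewrite prime_idealrM => /orP[/pm|]; first by rewrite (negbTE sm).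
  by elim: (k) => [|k' IHk]; [rewrite idealr1 | rewrite exprS prime_idealrM => /orP[]].
case/orP: wb => [/wb0 //|b0p].
have : a * w \in p by rewrite -(addKr b0 (a * w)) rpredD // rpredN.
by rewrite prime_idealrM => /orP[].
Qed.

(** Starting from [e] zeros, [kronecker] absorbs the members of [v] one by one without changing the
    number of elements. [radical_local] then turns the inclusion of zero sets into equations. *)
Lemma local_parameters e I (v : seq R) : ideal I ->
  (forall L c, punctured_chain I L c -> (L <= e)%N) -> {subset v <= m} ->
  exists ys : seq R, [/\ size ys = e, {subset ys <= m}
  & forall y, y \in v -> exists s k i u, [/\ s \notin m, I i, idl ys u & s * y ^+ k = i + u]].
Proof.
move=> idI bd vm.
suff [ys [sy ym hy]] : exists ys : seq R, [/\ size ys = e, {subset ys <= m}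
    & forall p, (forall x, I x -> x \in p) -> {subset p <= m} -> {subset ys <= p} -> {subset v <= p}].
  exists ys; split=> // y yv; have [|s [k [sm [i [u [Ii zu e1]]]]]] :=
    radical_local (m := m) (a := y) (ideal_idl ys idI); last by exists s, k, i, u.
  move=> p hp pm; apply: hy yv => // x; last move=> xy; last apply: hp.
    by move=> Ix; apply: hp; exists x, 0; rewrite addr0; split=> //; apply: idl0.
  by exists 0, x; rewrite add0r; split=> //; [case: idI | apply: idl_mem].
elim: v vm => [|y v IH] vm.
  by exists (nseq e 0); rewrite size_nseq; split=> // x /nseqP[-> _]; rewrite rpred0.
have [|ys [sy ym hy]] := IH; first by move=> x xv; apply: vm; rewrite inE xv orbT.
have [ys' [sy' ym' h h']] := kronecker idI bd (vm y (mem_head _ _)) sy.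
exists ys'; split=> //; first exact: ym'.
move=> p Ip pm yp; have yinp := h' p Ip pm yp.
by move=> x; rewrite inE => /orP[/eqP->//|]; apply: hy => //; apply: h.
Qed.
End Kronecker.
End Primes.

(** * The determinant trick *)

Section DetTrick.
Variables (R : comNzRingType) (M : lmodType R) (J : {pred R}) (s : seq M).
Hypothesis idJ : ideal (fun x => x \in J).
Hypothesis gen : forall x, exists c : nat -> R, x = \sum_(i < size s) c i *: s`_i.

Lemma ideal_det g (A B : 'M[R]_g) : (forall i j, A i j - B i j \in J) -> \det A - \det B \in J.
Proof.
have [J0 JD JM] := idJ; move=> AB.
apply: (big_ind2 (fun x y => x - y \in J)) => [|x x' y y' h h'|u _]; first by rewrite subrr.
  by rewrite opprD addrACA; apply: JD.
rewrite -mulrBr; apply: (JM).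
apply: (big_ind2 (fun x y => x - y \in J)) => [|x x' y y' h h'|i _] //; first by rewrite subrr.
have -> : x * y - x' * y' = y * (x - x') + x' * (y - y') by ring.
by apply: (JD); apply: (JM).
Qed.

Lemma smul_gen x : x \in smul J M ->
  exists f : nat -> R, (forall i, f i \in J) /\ x = \sum_(i < size s) f i *: s`_i.
Proof.
have [J0 JD JM] := idJ; case/asboolP => l + ->; elim: l => [|[a y] l IH] /=.
  by exists (fun=> 0); split=> //; rewrite big_nil big1 // => i _; rewrite scale0r.
case/andP => aJ /IH[f [fJ e]]; have [c ec] := gen y; exists (fun i => c i * a + f i).
split=> [i|]; first by apply/JD/fJ/JM.
rewrite big_cons e /= {1}ec scaler_sumr -big_split; apply: eq_bigr => i _.
by rewrite scalerDl scalerA mulrC.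
Qed.

(** If C is a matrix over [J] expressing y on the generators, then det(y - C) kills them by the
    adjugate, and it is congruent to y^g modulo [J], where g is the number of generators. *)
Lemma determinant_trick y : (forall x, y *: x \in smul J M) ->
  exists2 j, j \in J & forall x : M, (y ^+ size s + j) *: x = 0.
Proof.
have [J0 JD JM] := idJ => yJ.
have [f hf] := choice (fun i : 'I_(size s) => smul_gen (yJ s`_i)).
pose C : 'M[R]_(size s) := \matrix_(i, k) f i k.
pose A := y%:M - C.
exists (\det A - y ^+ size s).
  rewrite -[y ^+ _]det_scalar; apply: ideal_det => i k; rewrite !mxE addrAC subrr add0r -mulN1r.
  exact/JM/(hf i).1.
have rowA i : \sum_k A i k *: s`_k = 0.
  under eq_bigr do rewrite !mxE scalerBl.
  rewrite sumrB -(hf i).2 (bigD1 i) //= eqxx mulr1n big1 ?addr0 ?subrr // => k ki.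
  by rewrite eq_sym (negbTE ki) mulr0n scale0r.
have det_s (l : 'I_(size s)) : \det A *: s`_l = 0.
  have <- : \sum_k (\adj A *m A) l k *: s`_k = \det A *: s`_l.
    rewrite mul_adj_mx (bigD1 l) //= !mxE eqxx mulr1n big1 ?addr0 // => k kl.
    by rewrite mxE eq_sym (negbTE kl) mulr0n scale0r.
  under eq_bigr do rewrite mxE scaler_suml.
  rewrite exchange_big big1 // => i _.
  by under eq_bigr do rewrite -scalerA; rewrite -scaler_sumr rowA scaler0.
move=> x; rewrite addrC subrK; have [c ->] := gen x.
by rewrite scaler_sumr big1 // => i _; rewrite scalerA mulrC -scalerA det_s scaler0.
Qed.
End DetTrick.

(** * The colon modules of a partial system of parameters *)

Section Proj.
Variables (R : comNzRingType) (M : lmodType R) (N : submodClosed M).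

Lemma mq_proj_linear : linear (@mq_proj R M N).
Proof.
move=> a x y; rewrite /mq_proj -mq_addE; congr (_ + _).
by rewrite -[RHS]/(mq_scale _ _) mq_scale_pi.
Qed.
HB.instance Definition _ :=
  GRing.isLinear.Build R M (modquot N) _ (@mq_proj R M N) mq_proj_linear.

Lemma mq_proj_eq0 x : mq_proj N x = 0 <-> x \in N.
Proof. by rewrite -(linear0 (@mq_proj R M N)) mq_eqP subr0. Qed.
End Proj.

Section SmulSeq.
Variables (R : comNzRingType) (M : lmodType R).

Lemma smul_mem (A : {pred R}) a (x : M) : a \in A -> a *: x \in smul A M.
Proof. by move=> aA; apply/asboolP; exists [:: (a, x)]; rewrite /= ?aA // big_seq1. Qed.

Lemma smul_ind (A : {pred R}) (N : submodClosed M) :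
  (forall a x, a \in A -> a *: x \in N) -> {subset smul A M <= N}.
Proof.
move=> h _ /asboolP[l + ->]; elim: l => [|p l IH] /=; first by rewrite big_nil rpred0.
by case/andP => pA lA; rewrite big_cons rpredD ?h ?IH.
Qed.

Lemma smul_take (s : seq R) q x : x \in smul (mem (take q.+1 s)) M ->
  exists2 p, p \in smul (mem (take q s)) M & exists y, x = p + s`_q *: y.
Proof.
case/asboolP => l + ->; elim: l => [|[a y] l IH] /=.
  by exists 0; rewrite ?rpred0 //; exists 0; rewrite big_nil scaler0 addr0.
case/andP => aA /IH[p pP [z e]]; rewrite big_cons e /=.
have [qs|qs] := ltnP q (size s); last first.
  rewrite take_oversize ?(leq_trans qs) // -(take_oversize qs) in aA.
  exists (a *: y + p); last by exists z; rewrite addrA.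
  by rewrite rpredD // smul_mem.
have : a \in take q.+1 s by [].
rewrite (take_nth 0 qs) mem_rcons inE => /orP[/eqP->|{}aA].
  by exists p => //; exists (y + z); rewrite scalerDr addrCA.
exists (a *: y + p); last by exists z; rewrite addrA.
by rewrite rpredD // smul_mem.
Qed.

Lemma smul_sub (A B : {pred R}) : {subset A <= B} -> {subset smul A M <= smul B M}.
Proof. by move=> AB; apply: smul_ind => a x /AB aB; apply: smul_mem. Qed.

End SmulSeq.

Section SmulLoc.
Variables (R : comNzRingType) (M : lmodType R).

Lemma smul_frac (S : mulrClosed R) (A : {pred R}) (x : M) :
  x \in smul A M -> frac x (denom1 S) \in smul A (loc S M).
Proof.
case/asboolP => l + ->; elim: l => [|[a y] l IH] /=.
  by move=> _; rewrite big_nil; apply: rpred0.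
case/andP => aA /IH h; rewrite big_cons /=.
have -> : frac (a *: y + \sum_(p <- l) p.1 *: p.2) (denom1 S) =
    a *: frac y (denom1 S) + frac (\sum_(p <- l) p.1 *: p.2) (denom1 S).
  rewrite fracZ fracD !scale1r; congr frac; apply: val_inj; exact/esym/mulr1.
by apply: rpredD; [exact: smul_mem|exact: h].
Qed.

Lemma smul_locP (S : mulrClosed R) (A : {pred R}) (x : loc S M) :
  x \in smul A (loc S M) -> exists u (s : denom S), u \in smul A M /\ x = frac u s.
Proof.
case/asboolP => l + ->; elim: l => [|[a y] l IH] /=.
  by exists 0, (denom1 S); rewrite big_nil rpred0.
case/andP => aA /IH[u [s [uA e]]]; rewrite big_cons e /=.
elim/fracW: y => y s'; exists (val s *: (a *: y) + val s' *: u), (denomM s' s).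
split; last by rewrite fracZ fracD.
by apply: rpredD; apply: rpredZ => //; apply: smul_mem.
Qed.
End SmulLoc.

(** * The irrelevant ideal and the vanishing for the colon modules *)

Section Poly.
Variables (k : fieldType) (n : nat).
Local Notation R := {mpoly k[n.+1]}.

Definition vars : seq R := [seq 'X_i | i <- enum 'I_n.+1].

Lemma size_vars : size vars = n.+1. Proof. by rewrite size_map size_enum_ord. Qed.

Lemma nth_vars (i : 'I_n.+1) : vars`_i = 'X_i.
Proof. by rewrite (nth_map i) ?size_enum_ord // nth_ord_enum. Qed.

Definition irrel : {pred R} := fun p => p@_0 == 0.
Lemma irrelE p : (p \in irrel) = (p@_0 == 0). Proof. by []. Qed.
Lemma irrel_ideal : idealr_closed irrel.
Proof.
split; first by rewrite irrelE mcoeff0.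
  by rewrite irrelE mcoeff1 eqxx oner_eq0.
move=> a p q; rewrite !irrelE mcoeffD => /eqP p0 /eqP->.
by rewrite (rmorphM (mcoeff 0%MM : {rmorphism R -> k})) /= p0 mulr0 addr0.
Qed.
Lemma irrel_prime : prime_idealr_closed irrel.
Proof.
by move=> p q; rewrite !irrelE (rmorphM (mcoeff 0%MM : {rmorphism R -> k})) /= mulf_eq0.
Qed.
HB.instance Definition _ := isIdealr.Build R irrel irrel_ideal.
HB.instance Definition _ := isPrimeIdealrClosed.Build R irrel irrel_prime.

Lemma idl_vars p : p \in irrel -> idl vars p.
Proof.
rewrite irrelE => /eqP p0; rewrite (mpolyE p).
elim/big_ind: _ => [||m _]; [exact: idl0|exact: idlD|].
have [->|] := eqVneq m 0%MM; first by rewrite p0 scale0r; apply: idl0.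
move=> /eqP m0; have [i mi] : exists i, (0 < m i)%N.
  apply: contrapT => h; apply: m0; apply/mnmP => i; rewrite mnm0E.
  by apply/eqP; rewrite -leqn0 leqNgt; apply/negP => mi; apply: h; exists i.
have -> : m = (m - U_(i) + U_(i))%MM.
  rewrite submK //; apply/mnm_lepP => j; rewrite mnm1E.
  by case: eqP => // <-.
rewrite mpolyXD -mul_mpolyC mulrA; apply/idlM/idl_mem.
by rewrite -nth_vars mem_nth // size_vars.
Qed.

Lemma vars_irrel : {subset vars <= irrel}.
Proof.
move=> _ /mapP[i _ ->]; rewrite irrelE mcoeffX.
by rewrite mnm1_eq0.
Qed.

Lemma prime_complE (p : prime_idealr R) x : (x \in prime_compl p) = (x \notin p).
Proof. by []. Qed.

(** The inverse of the nonzero constant term inverts [s] modulo the variables. *)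
Lemma unit_irrel s : s \in prime_compl irrel ->
  exists2 s', s' \in prime_compl irrel & idl vars (1 - s' * s).
Proof.
rewrite prime_complE irrelE => s0; exists ((s@_0)^-1)%:MP.
  by rewrite prime_complE irrelE mcoeffC eqxx mulr1 invr_eq0.
by apply: idl_vars; rewrite irrelE mcoeffB mcoeff1 eqxx mul_mpolyC mcoeffZ mulVf ?subrr.
Qed.

Section Killed.
Variables (M : lmodType R) (t : nat) (gamma : t.-tuple R) (J : {pred R}) (eps : int) (e : nat).
Hypothesis fgM : fin_gen M.
Hypothesis hJ : homog_ideal J.
Hypothesis dimJ : dim_le (modquot (smul J M)) eps.
Hypothesis reg : regular_outside M J gamma.
Hypothesis eps_e : eps <= e%:Z.

Let idJ : ideal (fun x => x \in J).
Proof. by case: hJ => J0 JD JM _; split=> // a x; apply: JM. Qed.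

Let I (a : R) := forall x : M, a *: x \in smul J M.

Let idI : ideal I.
Proof.
split=> [x|a b Ia Ib x|a b Ib x]; first by rewrite scale0r rpred0.
  by rewrite scalerDl rpredD ?Ia ?Ib.
by rewrite -scalerA rpredZ ?Ib.
Qed.

(** Adding the irrelevant ideal on top of a nonempty punctured chain gives a chain of L + 1 primes
    over the annihilator of M / J M, and there are at most eps + 1 of these. *)
Let I_bound L c : punctured_chain irrel I L c -> (L <= e)%N.
Proof.
case: L => [//|L] [cU cs].
pose c' (i : 'I_L.+2) : prime_idealr R := if (i < L.+1)%N then c i else irrel.
have Iirr x : I x -> x \in irrel.
  by move=> Ix; have [h h' _] := cU 0%N erefl; apply/h'/h.
have /dimJ : prime_chain (modquot (smul J M)) c'.
  split=> [i a ha|i j ij].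
    have Ia : I a.
      by move=> x; apply/mq_proj_eq0; rewrite linearZ; apply: ha.
    rewrite /c'; case: ifP => [iL|_]; last exact: Iirr.
    by have [h _ _] := cU i iL; apply: h.
  rewrite /c'; have jL := ltn_ord j.
  have iL : (i < L.+1)%N by apply: leq_trans ij _; rewrite -ltnS.
  rewrite iL; case: ifP => [jL'|_]; first by apply: cs; rewrite ij.
  by have [] := cU i iL.
by move: eps_e; lia.
Qed.

(** It is enough that [b] lies in every prime p containing (P : a). Such a p contains J, since
    otherwise regularity at p would give an element outside p sending [a] into P. By the determinant
    trick b^g + j kills M for some j in J, so it lies in p, and [b] follows. *)
Let I_nilpotent q a b : (q < t)%N -> I b -> a \in colon (smul (mem (take q gamma)) M) gamma`_q ->
  exists L, b ^+ L *: a \in smul (mem (take q gamma)) M.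
Proof.
move=> qt Ib; rewrite colonE => ga.
set P := smul _ M in ga *.
have [] := @radical _ (fun r => r *: a \in P) b.
- split=> [|x y h h'|x y h]; first by rewrite scale0r rpred0.
    by rewrite scalerDl rpredD.
  by rewrite -scalerA rpredZ.
- move=> p hp.
  have Jp : {subset J <= p}.
    apply: contrapT => nJp.
    pose y : quo_seq (loc (prime_compl p) M) (take q gamma) :=
      mq_proj _ (frac a (denom1 (prime_compl p))).
    have y0 : y = 0.
      apply: (reg nJp (j := Ordinal qt)); rewrite /= (tnth_nth 0) /=.
      by rewrite -linearZ; apply/mq_proj_eq0; rewrite fracZ; apply: smul_frac.
    have : frac a (denom1 (prime_compl p)) \in smul (mem (take q gamma)) (loc (prime_compl p) M).
      exact/mq_proj_eq0.
    move=> /smul_locP[u [s [uP /fracP[v vp ev]]]].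
    have : v * val s \in p.
      by apply: hp; rewrite -scalerA ev rpredZ // scale1r.
    rewrite prime_idealrM -[_ \in p]negbK -[X in _ || X]negbK.
    by rewrite (vp : v \notin p) (valP s : val s \notin p).
  have [s hs] := fgM.
  have [j jJ hj] := determinant_trick idJ hs Ib.
  have : b ^+ size s + j \in p by apply: hp; rewrite hj rpred0.
  move=> bjp; have : b ^+ size s \in p by rewrite -(addrK j (b ^+ _)) rpredB // Jp.
  by elim: (size s) => [|k' IHk]; [rewrite idealr1 | rewrite exprS prime_idealrM => /orP[]].
by move=> L; exists L.
Qed.

Lemma vanishing_above_colon q : (q < t)%N ->
  vanishing_above vars (colon (smul (mem (take q gamma)) M) gamma`_q) (smul (mem (take q gamma)) M) e%:Z.
Proof.
move=> qt; have [ys [sy ym hy]] := local_parameters idI I_bound vars_irrel.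
rewrite -sy => N j c.
apply: (@vanish _ _ _ _ (prime_compl irrel) vars ys).
- by move=> x xys; apply/idl_vars/ym.
- exact: unit_irrel.
move=> N1 y yv a ha; have [s [r [b [u [sm Ib zu e1]]]]] := hy y yv.
have [L hL] := I_nilpotent qt Ib ha; have [K hK] := idl_pow N1 zu.
have [x [z ez]] := exprD_split b u L K.
(* From s y^r = b + u, the power (b + u)^(L + K) is x b^L + z u^K, where b^L sends [a] into P and
   u^K is in the ideal of the powers of [ys]. *)
exists (x * b ^+ L); last by rewrite -scalerA rpredZ.
exists (s ^+ (L + K)), (r * (L + K))%N, (z * u ^+ K); split.
- by apply: rpredX.
- exact: idlM.
by rewrite exprM -exprMn e1 ez addrK.
Qed.
End Killed.
End Poly.

(** * Graded components *)

Lemma sum_support (I : eqType) (V : zmodType) (f : I -> V) s s' : uniq s -> uniq s' ->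
  {subset s <= s'} -> (forall i, i \notin s -> f i = 0) -> \sum_(i <- s) f i = \sum_(i <- s') f i.
Proof.
move=> us us' ss' f0; rewrite [RHS](bigID (mem s)) /= [X in _ + X]big1 ?addr0; last by move=> i /f0.
rewrite -[RHS]big_filter; apply: perm_big; apply: uniq_perm; rewrite ?filter_uniq // => i.
by rewrite mem_filter /=; case: (boolP (i \in s)) => // /ss' ->.
Qed.

Section Comp.
Variables (k : fieldType) (n : nat).
Local Notation R := {mpoly k[n.+1]}.
Variables (M : lmodType R) (gr : int -> M -> Prop).
Hypothesis grM : is_grading gr.

Definition comp (x : M) : int -> M :=
  projT1 (cid (let: And4 _ _ h _ := grM in h x)).

Lemma comp_dec x : gr_decomp gr (comp x) x.
Proof. by rewrite /comp; case: cid. Qed.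

Lemma comp_uniq x f : gr_decomp gr f x -> comp x =1 f.
Proof. by have [_ _ _ h] := grM; apply: h; apply: comp_dec. Qed.

Lemma comp_gr x nu : gr nu (comp x nu). Proof. by have [] := comp_dec x. Qed.

Lemma gr0 nu : gr nu 0. Proof. by have [h _ _ _] := grM; have [] := h nu. Qed.
Lemma grB nu x y : gr nu x -> gr nu y -> gr nu (x - y).
Proof. by have [h _ _ _] := grM; have [_] := h nu; apply. Qed.

Lemma compB x y nu : comp (x - y) nu = comp x nu - comp y nu.
Proof.
apply: (@comp_uniq _ (fun nu => comp x nu - comp y nu)); split.
  by move=> mu; apply: grB; apply: comp_gr.
have [_ [s [us s0 es]]] := comp_dec x; have [_ [s' [us' s0' es']]] := comp_dec y.
exists (undup (s ++ s')); split; first exact: undup_uniq.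
  by move=> mu; rewrite mem_undup mem_cat negb_or => /andP[/s0-> /s0'->]; rewrite subrr.
rewrite {1}es {1}es' sumrB; congr (_ - _); apply: sum_support => //; try exact: undup_uniq.
  by move=> mu h; rewrite mem_undup mem_cat h.
by move=> mu h; rewrite mem_undup mem_cat h orbT.
Qed.

Lemma comp0 nu : comp 0 nu = 0. Proof. by rewrite -[in LHS](subrr 0) compB subrr. Qed.
Lemma compN x nu : comp (- x) nu = - comp x nu. Proof. by rewrite -sub0r compB comp0 sub0r. Qed.
Lemma compD x y nu : comp (x + y) nu = comp x nu + comp y nu.
Proof. by rewrite -[in LHS](opprK y) compB compN opprK. Qed.

Lemma comp_homog nu x mu : gr nu x -> comp x mu = if mu == nu then x else 0.
Proof.
move=> gx; apply: (@comp_uniq _ (fun mu => if mu == nu then x else 0)); split.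
  by move=> mu'; case: eqP => [->//|_]; apply: gr0.
exists [:: nu]; split=> //; last by rewrite big_seq1 eqxx.
by move=> mu'; rewrite inE => /negbTE->.
Qed.

Lemma comp_scale (d : nat) (p : R) x nu : p \is d.-homog -> comp (p *: x) (nu + d%:Z) = p *: comp x nu.
Proof.
move=> pd; have [_ hp _ _] := grM.
rewrite (@comp_uniq _ (fun mu => p *: comp x (mu - d%:Z))) ?addrK //; split.
  by move=> mu; rewrite -[X in gr X _](subrK d%:Z); apply: hp; [exact: pd|exact: comp_gr].
have [_ [s [us s0 es]]] := comp_dec x; exists [seq mu + d%:Z | mu <- s]; split.
- by rewrite map_inj_uniq //; apply: addIr.
- move=> mu hmu; rewrite s0 ?scaler0 //; apply: contra hmu => h.
  by apply/mapP; exists (mu - d%:Z); rewrite ?subrK.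
- by rewrite big_map {1}es scaler_sumr; apply: eq_bigr => mu _; rewrite addrK.
Qed.

Lemma comp_scaleB (d : nat) (p : R) x nu : p \is d.-homog -> comp (p *: x) nu = p *: comp x (nu - d%:Z).
Proof. by move=> pd; rewrite -(comp_scale _ _ pd) subrK. Qed.

Lemma comp_smul (s : seq R) x nu : (forall a, a \in s -> exists d : nat, a \is d.-homog) ->
  x \in smul (mem s) M -> comp x nu \in smul (mem s) M.
Proof.
move=> hs; case/asboolP => l + ->; elim: l => [|p l IH] /=; first by rewrite big_nil comp0 rpred0.
case/andP => pA lA; rewrite big_cons compD rpredD ?IH //.
by have [d pd] := hs _ pA; rewrite (comp_scaleB _ _ pd) smul_mem.
Qed.

(** The determinant trick gives j in m with (1 + j) M = 0. For x homogeneous of degree nu, all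
    components of j x have degree above nu, so the component of (1 + j) x in degree nu is x. *)
Lemma graded_nakayama : fin_gen M -> (forall x, x \in smul (@irrel k n) M) -> forall x : M, x = 0.
Proof.
move=> [s hs] h.
have idm : ideal (fun x => x \in @irrel k n).
  by split=> [|x y|a x]; [exact: rpred0|exact: rpredD|exact: idealMr].
have [|j jm hj] := determinant_trick idm hs (y := 1); first by move=> x; rewrite scale1r.
move: hj; rewrite expr1n => hj.
have hom0 nu x : gr nu x -> x = 0.
  move=> gx; have := comp0 nu; rewrite -{1}(hj x) scalerDl scale1r compD (comp_homog nu gx) eqxx.
  suff -> : comp (j *: x) nu = 0 by rewrite addr0.
  rewrite [j]mpolyE scaler_suml (big_morph (fun y => comp y nu) (fun x y => compD x y nu) (comp0 nu)).
  rewrite big1 // => m _.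
  have [->|m0] := eqVneq m 0%MM.
    by move: jm; rewrite irrelE => /eqP->; rewrite !scale0r comp0.
  have mh : (j@_m *: 'X_[m] : R) \is (mdeg m).-homog by apply: dhomogZ; rewrite dhomogX.
  rewrite (comp_scaleB _ _ mh) (comp_homog _ gx).
  have : (0 < mdeg m)%N by rewrite lt0n mdeg_eq0.
  by case: eqP => [|_ _]; [lia|rewrite scaler0].
move=> x; have [_ [s' [_ _ ->]]] := comp_dec x.
by rewrite big1 // => nu _; apply: (hom0 nu); apply: comp_gr.
Qed.

(** A prime over the annihilator contains powers of all variables, hence the maximal ideal m, which
    excludes chains of two primes. The chain consisting of m exists because an annihilating element
    with nonzero constant term would give M = m M, against Nakayama. *)
Lemma has_dim0_quo (z : seq R) N : fin_gen M -> (exists x : M, x != 0) -> {subset z <= @irrel k n} ->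
  (forall i : 'I_n.+1, 'X_i ^+ N \in z) -> has_dim (quo_seq M z) 0.
Proof.
move=> fgM nz zm Xz.
have zann a : a \in z -> forall x : quo_seq M z, a *: x = 0.
  move=> az; elim/mq_ind => x; rewrite -[X in _ *: X]/(mq_proj _ x) -linearZ.
  by apply/mq_proj_eq0; apply: smul_mem.
split.
  move=> m c [cI cs]; case: m c cI cs => [|[|m]] c cI cs //.
  have [_ []] := cs ord0 (lift ord0 ord0) erefl.
  have irr0 : {subset @irrel k n <= c ord0}.
    move=> p /idl_vars[f ->]; apply: rpred_sum => i _; apply: idealMr.
    have iN : (i < n.+1)%N by have := ltn_ord i; rewrite [X in (_ < X)%N]size_vars.
    have -> : (vars k n)`_i = 'X_(Ordinal iN) by rewrite -nth_vars.
    have : 'X_(Ordinal iN) ^+ N \in c ord0 by apply: cI; apply/zann/Xz.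
    by elim: (N) => [|N' IH]; [rewrite idealr1|rewrite exprS prime_idealrM => /orP[]].
  move=> p pc; apply: contraT => npc.
  have p0 : p@_0 != 0 by apply: contra npc => h; apply: irr0.
  have : ((p@_0)^-1)%:MP * p \in c (lift ord0 ord0) by apply: idealMr.
  have : ((p@_0)^-1)%:MP * p - 1 \in c (lift ord0 ord0).
    have [h _] := cs ord0 (lift ord0 ord0) erefl; apply/h/irr0.
    by rewrite irrelE mcoeffB mcoeff1 eqxx mul_mpolyC mcoeffZ mulVf ?subrr.
  move=> h1 h2; have := rpredB h2 h1; rewrite opprB addrCA subrr addr0.
  by rewrite idealr1.
exists 1%N, (fun=> (@irrel k n : prime_idealr R)); split=> //; split; last by move=> i j; rewrite !ord1.
move=> _ a ha; apply: contraT; rewrite irrelE => a0.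
have [x /eqP[]] := nz; apply: graded_nakayama => // y.
have := ha (mq_proj _ y); rewrite -linearZ => /mq_proj_eq0 hy.
have hy' : a *: y \in smul (@irrel k n) M by apply: smul_sub hy.
have -> : y = ((a@_0)^-1)%:MP *: (a *: y) - (((a@_0)^-1)%:MP * a - 1) *: y.
  by rewrite scalerA scalerBl scale1r subKr.
rewrite -scaleNr; apply: rpredD; [exact: rpredZ|apply: smul_mem; rewrite rpredN irrelE].
by rewrite mcoeffB mcoeff1 eqxx mul_mpolyC mcoeffZ mulVf ?subrr.
Qed.

(* The part of degree [nu] in the Koszul complex of elements of degrees [es]; a cochain [c] is
   homogeneous of degree [nu] if and only if [kcomp es nu c = c]. *)
Fixpoint kcomp (es : seq nat) (nu : int) r : kos M r -> kos M r :=
  match r return kos M r -> kos M r with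
  | 0 => fun x => comp x nu
  | r'.+1 => fun c => (kcomp (behead es) nu c.1, kcomp (behead es) (nu + (head 0%N es)%:Z) c.2)
  end.

Lemma kcompB es nu r (c c' : kos M r) : kcomp es nu (c - c') = kcomp es nu c - kcomp es nu c'.
Proof.
elim: r es nu c c' => [|r IH] es nu c c' /=; first exact: compB.
by apply: kos_eq; rewrite /= IH.
Qed.
Lemma kcomp0 es nu r : kcomp es nu (0 : kos M r) = 0.
Proof. by rewrite -[in LHS](subrr 0) kcompB subrr. Qed.

Lemma kcomp_scale (d : nat) (p : R) es nu r (c : kos M r) : p \is d.-homog ->
  kcomp es (nu + d%:Z) (p *: c) = p *: kcomp es nu c.
Proof.
move=> pd; elim: r es nu c => [|r IH] es nu c /=; first exact: comp_scale.
by apply: kos_eq; rewrite /= ?IH // addrAC IH.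
Qed.

Lemma kcomp_kd z es nu r (c : kos M r) :
  (forall i, (i < r)%N -> z`_i \is (nth 0%N es i).-homog) ->
  kcomp es nu (kd z c) = kd z (kcomp es nu c).
Proof.
elim: r z es nu c => [|r IH] z es nu c h; first exact: comp0.
have h' i : (i < r)%N -> (behead z)`_i \is (nth 0%N (behead es) i).-homog.
  by move=> ir; rewrite !nth_behead; apply: h.
apply: kos_eq; rewrite /= ?IH // kcompB IH // kcomp_scale //.
by have := h 0%N erefl; rewrite -!nth0.
Qed.

Lemma kcomp_up w es es' nu r (c : kos M r) :
  (forall i, (i < r)%N -> (nth 0 es i <= nth 0 es' i)%N /\
      nth 1 w i \is (nth 0 es' i - nth 0 es i)%N.-homog) ->
  kcomp es' nu (up w c) = up w (kcomp es nu c).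
Proof.
elim: r w es es' nu c => [//|r IH] w es es' nu c h.
have h' i : (i < r)%N -> (nth 0 (behead es) i <= nth 0 (behead es') i)%N /\
      nth 1 (behead w) i \is (nth 0 (behead es') i - nth 0 (behead es) i)%N.-homog.
  by move=> ir; rewrite !nth_behead; apply: h.
have [h0 w0] := h 0%N erefl; rewrite !nth0 in h0 w0.
apply: kos_eq; rewrite /= ?(IH _ _ _ _ _ h') //.
have -> : nu + (head 0%N es')%:Z = nu + (head 0%N es)%:Z + (head 0%N es' - head 0%N es)%N%:Z by lia.
by rewrite kcomp_scale // (IH _ _ _ _ _ h').
Qed.

Lemma chain_kcomp (P : submodClosed M) es nu r j (c : kos M r) :
  (forall x mu, x \in P -> comp x mu \in P) -> c \in chain P r j -> kcomp es nu c \in chain P r j.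
Proof.
move=> hP; elim: r es nu j c => [|r IH] es nu j c.
  by rewrite !chain0E; case: ifP => _; [exact: hP|move/eqP->; rewrite /= comp0].
by rewrite !chainS => /andP[/IH h1 /IH h2] /=; rewrite h1 h2.
Qed.

Lemma top_kcomp es1 es2 nu h r (c : kos M (h + r)) : size es1 = h ->
  top (kcomp (es1 ++ es2) nu c) = kcomp es2 (nu + (sumn es1)%:Z) (top c).
Proof.
move=> sh; subst h; elim: es1 nu c => [|e es1 IH] nu c; first by rewrite addr0.
by rewrite /= IH -addrA -PoszD.
Qed.

Lemma kcomp_support es r (c : kos M r) :
  exists s, [/\ uniq s, forall nu, nu \notin s -> kcomp es nu c = 0 & c = \sum_(nu <- s) kcomp es nu c].
Proof.
elim: r es c => [|r IH] es c; first by have [_] := comp_dec c.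
have [s1 [us1 s10 e1]] := IH (behead es) c.1; have [s2 [us2 s20 e2]] := IH (behead es) c.2.
set d := (head 0%N es)%:Z.
have us2' : uniq [seq nu - d | nu <- s2] by rewrite map_inj_uniq //; apply: addIr.
have s20' nu : nu \notin [seq nu - d | nu <- s2] -> kcomp (behead es) (nu + d) c.2 = 0.
  move=> h; apply: s20; apply: contra h => h; apply/mapP; exists (nu + d) => //.
  by rewrite addrK.
exists (undup (s1 ++ [seq nu - d | nu <- s2])); split; first exact: undup_uniq.
  move=> nu; rewrite mem_undup mem_cat negb_or => /andP[h1 h2].
  by apply: kos_eq; rewrite /= ?s10 ?s20'.
set s := undup _.
have sum1 (F : int -> kos M r.+1) : (\sum_(nu <- s) F nu).1 = \sum_(nu <- s) (F nu).1.
  by apply: (big_morph (fun x : kos M r.+1 => x.1)).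
have sum2 (F : int -> kos M r.+1) : (\sum_(nu <- s) F nu).2 = \sum_(nu <- s) (F nu).2.
  by apply: (big_morph (fun x : kos M r.+1 => x.2)).
apply: kos_eq; rewrite ?sum1 ?sum2 /=.
  rewrite {1}e1; apply: sum_support; rewrite ?undup_uniq // => nu h.
  by rewrite mem_undup mem_cat h.
rewrite -(@sum_support _ _ (fun nu => kcomp (behead es) (nu + d) c.2) [seq nu - d | nu <- s2] s) //.
- by rewrite {1}e2 big_map; apply: eq_bigr => nu _; rewrite subrK.
- exact: undup_uniq.
by move=> nu h; rewrite mem_undup mem_cat h orbT.
Qed.
End Comp.

(** * Comparison with Koszul cohomology *)

Section Tail.
Variable r : nat.
Implicit Type S : {set 'I_r.+1}.

Definition set_tail S : {set 'I_r} := [set i | lift ord0 i \in S].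

Lemma set_tail_lift (S : {set 'I_r}) : set_tail (lift ord0 @: S) = S.
Proof. by apply/setP => i; rewrite inE mem_imset //; apply: lift_inj. Qed.
Lemma ord0_lift (S : {set 'I_r}) : (ord0 \in lift ord0 @: S) = false.
Proof. by apply/imsetP => -[i _ e]; have := neq_lift ord0 i; rewrite -e eqxx. Qed.
Lemma set_tail_cons (S : {set 'I_r}) : set_tail (ord0 |: lift ord0 @: S) = S.
Proof.
apply/setP => i; rewrite !inE mem_imset; last exact: lift_inj.
by rewrite eq_sym (negbTE (neq_lift _ _)).
Qed.
Lemma set_tailK S : S = if ord0 \in S then ord0 |: lift ord0 @: set_tail S else lift ord0 @: set_tail S.
Proof.
apply/setP => i; case: (unliftP ord0 i) => [j|] ->; case: ifP => S0.
- by rewrite !inE mem_imset ?inE ?[_ == ord0]eq_sym ?(negbTE (neq_lift _ _)) //; apply: lift_inj.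
- by rewrite mem_imset ?inE //; apply: lift_inj.
- by rewrite !inE eqxx.
- by rewrite ord0_lift.
Qed.
Lemma card_set_tail S : #|S| = ((ord0 \in S) + #|set_tail S|)%N.
Proof.
rewrite [in LHS](set_tailK S); case: ifP => S0.
  by rewrite cardsU1 ord0_lift card_imset //; apply: lift_inj.
by rewrite card_imset //; apply: lift_inj.
Qed.
Lemma set_tailD0 S : set_tail (S :\ ord0) = set_tail S.
Proof. by apply/setP => i; rewrite !inE eq_sym neq_lift. Qed.
Lemma set_tailD S j : set_tail (S :\ lift ord0 j) = set_tail S :\ j.
Proof. by apply/setP => i; rewrite !inE (inj_eq (@lift_inj _ ord0)). Qed.

Lemma sum_set_tail (V : zmodType) (S : {set 'I_r.+1}) (F : 'I_r.+1 -> V) :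
  \sum_(j in S) F j = (if ord0 \in S then F ord0 else 0) + \sum_(j in set_tail S) F (lift ord0 j).
Proof.
rewrite big_mkcond big_ord_recl; congr (_ + _); rewrite [RHS]big_mkcond.
by apply: eq_bigr => i _; rewrite inE.
Qed.
Lemma card_below S j :
  #|[set k in S | (k < lift (ord0 : 'I_r.+1) j)%N]| =
  (((ord0 : 'I_r.+1) \in S) + #|[set k in set_tail S | (k < j)%N]|)%N.
Proof.
rewrite card_set_tail inE /= andbT; congr (_ + _)%N; apply: eq_card => i.
by rewrite !inE /= !/bump /= !add1n ltnS.
Qed.
End Tail.

Section Eval.
Variables (R : comNzRingType) (M : lmodType R).

(** The entry of a cochain at an index set. With [mk] this translates between the nested pairs,
    suited to induction on the elements, and the cochains indexed by sets. *)
Fixpoint ev r : kos M r -> {set 'I_r} -> M :=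
  match r return kos M r -> {set 'I_r} -> M with
  | 0 => fun x _ => x
  | r'.+1 => fun c S => if ord0 \in S then ev c.2 (set_tail S) else ev c.1 (set_tail S)
  end.

Fixpoint mk r : ({set 'I_r} -> M) -> kos M r :=
  match r return ({set 'I_r} -> M) -> kos M r with
  | 0 => fun f => f set0
  | r'.+1 => fun f => (mk (fun S : {set 'I_r'} => f (lift ord0 @: S)),
                       mk (fun S : {set 'I_r'} => f (ord0 |: lift ord0 @: S)))
  end.

Lemma ev_mk r f S : ev (@mk r f) S = f S.
Proof.
elim: r f S => [|r IH] f S /=; first by congr f; apply/setP => -[].
by rewrite [in RHS](set_tailK S); case: ifP; rewrite IH.
Qed.

Lemma ev_inj r (c c' : kos M r) : ev c =1 ev c' -> c = c'.
Proof.
elim: r c c' => [|r IH] c c' h; first exact: (h set0).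
apply: kos_eq; apply: IH => S.
  by have := h (lift ord0 @: S); rewrite /= ord0_lift set_tail_lift.
by have := h (ord0 |: lift ord0 @: S); rewrite /= !inE eqxx /= set_tail_cons.
Qed.

Lemma evB r (c c' : kos M r) S : ev (c - c') S = ev c S - ev c' S.
Proof. by elim: r c c' S => [//|r IH] c c' S /=; case: ifP; rewrite IH. Qed.
Lemma evD r (c c' : kos M r) S : ev (c + c') S = ev c S + ev c' S.
Proof. by elim: r c c' S => [//|r IH] c c' S /=; case: ifP; rewrite IH. Qed.
Lemma evZ r a (c : kos M r) S : ev (a *: c) S = a *: ev c S.
Proof. by elim: r c S => [//|r IH] c S /=; case: ifP; rewrite IH. Qed.
Lemma ev0 r S : ev (0 : kos M r) S = 0.
Proof. by elim: r S => [//|r IH] S /=; case: ifP; rewrite IH. Qed.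

Lemma ev_sum (I : Type) (s : seq I) r (F : I -> kos M r) S :
  ev (\sum_(i <- s) F i) S = \sum_(i <- s) ev (F i) S.
Proof. by apply: (big_morph (fun c => ev c S)) => [x y|]; rewrite ?evD ?ev0. Qed.

Lemma ev_kd z r (c : kos M r) S : ev (kd z c) S =
  \sum_(j in S) (-1) ^+ #|[set k in S | (k < j)%N]| *: (z`_j *: ev c (S :\ j)).
Proof.
elim: r z c S => [|r IH] z c S; first by rewrite big1 // => -[].
rewrite sum_set_tail.
have -> : \sum_(j in set_tail S) (-1) ^+ #|[set k in S | (k < lift ord0 j)%N]| *:
    (z`_(lift ord0 j) *: ev c (S :\ lift ord0 j)) =
  (-1) ^+ (ord0 \in S) *: ev (kd (behead z) (if ord0 \in S then c.2 else c.1)) (set_tail S).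
  rewrite IH scaler_sumr; apply: eq_bigr => j _.
  rewrite card_below exprD -scalerA; congr (_ *: (_ *: _)).
  rewrite nth_behead /= set_tailD !inE neq_lift.
  by case: (ord0 \in S).
rewrite [ev _ S]/=; case: ifP => S0; last by rewrite add0r scale1r.
rewrite evB evZ /= scaleN1r !inE eqxx /= set_tailD0 nth0.
have -> : [set k in S | (k < (ord0 : 'I_r.+1))%N] = set0 by apply/setP => i; rewrite !inE ltn0 andbF.
by rewrite cards0 scale1r.
Qed.

Lemma ev_chain (P : submodClosed M) r (j : int) (c : kos M r) : c \in chain P r j -> forall S, ev c S \in P.
Proof.
elim: r j c => [|r IH] j c; first by rewrite chain0E; case: ifP => _ => [//|/eqP-> S]; apply: rpred0.
by rewrite chainS => /andP[/IH h1 /IH h2] S /=; case: ifP.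
Qed.

Lemma ev_chain0 (P : submodClosed M) r (j : int) (c : kos M r) (S : {set 'I_r}) :
  c \in chain P r j -> #|S|%:Z != j -> ev c S = 0.
Proof.
elim: r j c S => [|r IH] j c S.
  rewrite chain0E [#|S|](_ : _ = 0%N); first by rewrite eq_sym => + /negbTE h; rewrite h => /eqP.
  by apply: eq_card0 => -[].
rewrite chainS card_set_tail => /andP[c1 c2] /=; case: ifP => S0 h.
  apply: (IH _ _ _ c2); apply: contra h; rewrite [(true + _)%N]add1n => /eqP h.
  by apply/eqP; rewrite intS h addrC subrK.
by apply: (IH _ _ _ c1).
Qed.

Lemma chain_ev (P : submodClosed M) r (j : int) (c : kos M r) :
  (forall S, ev c S \in P) -> (forall S : {set 'I_r}, #|S|%:Z != j -> ev c S = 0) -> c \in chain P r j.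
Proof.
elim: r j c => [|r IH] j c hP h0.
  rewrite chain0E; case: eqP => [_|/eqP jn]; first exact: (hP set0).
  by apply/eqP/(h0 set0); rewrite cards0 eq_sym.
rewrite chainS; apply/andP; split; apply: IH => S.
- by have := hP (lift ord0 @: S); rewrite /= ord0_lift set_tail_lift.
- by move=> h; have := h0 (lift ord0 @: S); rewrite /= card_set_tail ord0_lift set_tail_lift; apply.
- by have := hP (ord0 |: lift ord0 @: S); rewrite /= !inE eqxx /= set_tail_cons.
move=> h; have := h0 (ord0 |: lift ord0 @: S); rewrite /= card_set_tail !inE eqxx /= set_tail_cons; apply.
by apply: contra h => /eqP <-; rewrite [X in Posz X - 1]add1n intS addrC addKr.
Qed.

Lemma ev_up w r (c : kos M r) S : ev (up w c) S = (\prod_(j in S) nth 1 w j) *: ev c S.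
Proof.
elim: r w c S => [|r IH] w c S; first by rewrite big1 ?scale1r // => -[].
have -> : \prod_(j in S) nth 1 w j = (if ord0 \in S then head 1 w else 1) * \prod_(j in set_tail S) nth 1 (behead w) j.
  rewrite big_mkcond big_ord_recl /= -nth0; congr (_ * _); rewrite [RHS]big_mkcond.
  by apply: eq_bigr => i _; rewrite inE nth_behead.
by rewrite upS /=; case: ifP => S0; rewrite ?evZ IH ?scalerA ?mul1r.
Qed.
End Eval.

Section EvalGraded.
Variables (k : fieldType) (n : nat).
Local Notation R := {mpoly k[n.+1]}.
Variables (M : lmodType R) (gr : int -> M -> Prop).
Hypothesis grM : is_grading gr.

Lemma ev_kcomp es nu r (c : kos M r) S : ev (kcomp grM es nu c) S =
  comp grM (ev c S) (nu + \sum_(j in S) (nth 0%N es j)%:Z).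
Proof.
elim: r es nu c S => [|r IH] es nu c S; first by rewrite big1 ?addr0 // => -[].
rewrite sum_set_tail /=; under eq_bigr do rewrite -nth_behead.
by case: ifP => S0; rewrite IH ?add0r // -nth0 addrA.
Qed.
End EvalGraded.

(** * The descent from M_(l+1) to M_l in a single degree *)

Section Core.
Variables (k : fieldType) (n : nat).
Local Notation R := {mpoly k[n.+1]}.
Variables (M : lmodType R) (gr : int -> M -> Prop).
Hypothesis grM : is_grading gr.

Section KoszulKill.
Variables (r : nat) (z : r.-tuple R) (es : r.-tuple nat) (i : nat).
Hypothesis z_homog : forall j, tnth z j \is (tnth es j).-homog.

Definition kos_coch (c : kos M r) : cochain (fun _ : {set 'I_r} => M) := cochain_of (ev c).

Lemma kos_coch_kd c : cdiff (@koszul_map k n M r z) (kos_coch c) = kos_coch (kd z c).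
Proof.
apply/ffunP => S; rewrite !ffunE ev_kd; apply: eq_bigr => j _.
by rewrite /koszul_map /= ffunE (tnth_nth 0).
Qed.

Lemma kos_coch_cocycle c : c \in chain full r i%:Z -> kd z c = 0 ->
  kos_coch c \in cocycle (@koszul_map k n M r z) i.
Proof.
move=> ci dc; rewrite unfold_in /cocycle; apply/andP; split.
  by apply/forallP => S; apply/implyP => Si; rewrite ffunE (ev_chain0 ci).
by rewrite kos_coch_kd dc; apply/eqP/ffunP => S; rewrite !ffunE ev0.
Qed.

(** The classes of the homogeneous parts of x c form a decomposition of x times the class of [c], so
    the annihilator condition applies to each of them. *)
Lemma koszul_kill N x (c : kos M r) nu : ann_above (@koszul_gr k n M r z gr es i) N x ->
  c \in chain full r i%:Z -> kd z c = 0 -> gtz nu N ->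
  exists2 b, b \in chain full r (i%:Z - 1) & kd z b = kcomp grM es nu (x *: c).
Proof.
move=> hx ci dc nuN; set y := x *: c.
have hz j : (j < r)%N -> (tval z)`_j \is (nth 0%N es j).-homog.
  by move=> jr; have := z_homog (Ordinal jr); rewrite (tnth_nth 0) (tnth_nth 0%N).
have yi : y \in chain full r i%:Z by apply: rpredZ.
have dy : kd z y = 0 by rewrite linearZ /= dc scaler0.
have cyi mu : kcomp grM es mu y \in chain full r i%:Z by apply: chain_kcomp yi.
have dcy mu : kd z (kcomp grM es mu y) = 0 by rewrite -kcomp_kd // dy kcomp0.
pose Z mu := Cocycle (kos_coch_cocycle (cyi mu) (dcy mu)).
pose h : koszul M z i := mq_proj (@coboundary _ _ _ _ i) (Cocycle (kos_coch_cocycle ci dc)).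
pose f mu : koszul M z i := mq_proj (@coboundary _ _ _ _ i) (Z mu).
have fdec : gr_decomp (@koszul_gr k n M r z gr es i) f (x *: h).
  split=> [mu|].
    exists (Z mu) => // S; rewrite ffunE ev_kcomp.
    have -> : \sum_(j in S) (nth 0%N es j)%:Z = \sum_(j in S) (tnth es j)%:Z.
      by apply: eq_bigr => j _; rewrite (tnth_nth 0%N).
    exact: comp_gr.
  have [s [us s0 es']] := kcomp_support grM es y; exists s; split=> //.
    move=> mu /s0 e0; apply/mq_proj_eq0.
    have -> : Z mu = 0 by apply/val_inj/ffunP => S /=; rewrite !ffunE e0 ev0.
    exact: rpred0.
  rewrite /f /h -linearZ -linear_sum; congr mq_proj; apply/val_inj/ffunP => S.
  have sumv (F : int -> cocycles (@koszul_map k n M r z) i) :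
      cocycle_val (\sum_(mu <- s) F mu) S = \sum_(mu <- s) cocycle_val (F mu) S.
    by apply: (big_morph (fun v => cocycle_val v S)) => [a b|]; rewrite ?ffunE.
  rewrite [RHS]sumv /= !ffunE -evZ -/y {1}es' ev_sum.
  by apply: eq_bigr => mu _; rewrite ffunE.
have := hx nu nuN h f fdec; move/mq_proj_eq0/asboolP => [g /forallP gi eg].
exists (mk (g : {set 'I_r} -> M)).
  apply: chain_ev => // S Si; rewrite ev_mk; apply/eqP/(implyP (gi S)).
  by apply: contra Si => /eqP <-; rewrite intS addrC addKr.
apply: ev_inj => S; have := congr1 (fun u : cochain _ => u S) eg; rewrite /= !ffunE => ->.
by rewrite ev_kd; apply: eq_bigr => j _; rewrite ev_mk /koszul_map /= (tnth_nth 0).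
Qed.
End KoszulKill.

Local Notation X := (vars k n).
Variables (d : int) (mu : option int) (t : nat) (gamma : t.-tuple R) (e : t.-tuple nat).
Variables (J : {pred R}) (eps : int).
Hypothesis fgM : fin_gen M.
Hypothesis gamma_deg : forall j, tnth gamma j \is (tnth e j).-homog /\ (0 < tnth e j)%N.
Hypothesis hJ : homog_ideal J.
Hypothesis dimJ : dim_le (modquot (smul J M)) eps.
Hypothesis reg : regular_outside M J gamma.

Definition gamma_sub q : submodClosed M := smul (mem (take q gamma)) M.

Lemma segment_take l : (l <= t)%N -> segment (nth 0 gamma) 0 l = take l gamma.
Proof. by move=> lt; rewrite /segment map_nth_iota0 // size_tuple. Qed.

Lemma gamma_homog q : (q < t)%N -> gamma`_q \is (nth 0%N e q).-homog /\ (0 < nth 0%N e q)%N.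
Proof. by move=> qt; have := gamma_deg (Ordinal qt); rewrite (tnth_nth 0) (tnth_nth 0%N). Qed.

Lemma homog_irrel m (p : R) : p \is m.-homog -> (0 < m)%N -> p \in @irrel k n.
Proof.
move=> pm m0; rewrite irrelE; apply/eqP; apply: (dhomog_nemf_coeff pm).
have : mdeg (0%MM : 'X_{1..n.+1}) != m by rewrite mdeg0 eq_sym -lt0n.
exact.
Qed.

Lemma gamma_sub_comp q x nu : x \in gamma_sub q -> comp grM x nu \in gamma_sub q.
Proof.
apply: comp_smul => a /mem_take /(nthP 0)[j]; rewrite size_tuple => jt <-.
by exists (nth 0%N e j); have [] := gamma_homog jt.
Qed.

Lemma gamma_sub_mono q q' : (q <= q')%N -> {subset gamma_sub q <= gamma_sub q'}.
Proof.
move=> qq'; apply: smul_sub => a; rewrite /= -[X in X -> _]/(is_true (a \in take q gamma)) => aq.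
by have := mem_take (n0 := q) (x := a) (s := take q' gamma); rewrite take_takel //; apply.
Qed.

Lemma homog_vars_pow N j : (j < size X)%N -> (pow N X)`_j \is (nth 0%N (nseq n.+1 N) j).-homog.
Proof.
rewrite size_vars => jn; rewrite nth_nseq jn (nth_map 0) ?size_vars // (nth_vars k (Ordinal jn)).
have XH : ('X_(Ordinal jn) : R) \is 1.-homog by rewrite dhomogX; apply/eqP/mdeg1.
by have := dhomogMn N XH; rewrite mul1n.
Qed.

Lemma homog_sequence l N j : (l <= t)%N -> (j < l + size X)%N ->
  (take l gamma ++ pow N X)`_j \is (nth 0%N (take l e ++ nseq n.+1 N) j).-homog.
Proof.
move=> lt jl; rewrite !nth_cat !size_takel ?size_tuple //; case: ltnP => jl'.
  by rewrite !nth_take //; have [] := gamma_homog (leq_trans jl' lt).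
by apply: homog_vars_pow; lia.
Qed.

Lemma sequence_ZM l N (z : (l + size X).-tuple R) (es : (l + size X).-tuple nat) :
  (exists x : M, x != 0) -> (l <= t)%N -> z = take l gamma ++ pow N.+1 X :> seq R ->
  es = take l e ++ nseq n.+1 N.+1 :> seq nat -> in_ZM M z es.
Proof.
move=> nz lt ez ees.
have pos j : (j < l + size X)%N -> (0 < nth 0%N es j)%N.
  move=> jl; rewrite ees nth_cat size_takel ?size_tuple //; case: (ltnP j l) => jl'.
    by rewrite nth_take //; have [] := gamma_homog (leq_trans jl' lt).
  by rewrite nth_nseq; case: ifP => //; rewrite size_vars in jl; lia.
have hom j : (j < l + size X)%N -> (tval z)`_j \is (nth 0%N es j).-homog.
  by move=> jl; rewrite ez ees; apply: homog_sequence.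
split=> [j|].
  by rewrite (tnth_nth 0) (tnth_nth 0%N); split=> [|_]; [apply: hom|apply: pos].
apply: (@has_dim0_quo k n M gr grM z N.+1) => //.
  move=> a /(nthP 0)[j]; rewrite size_tuple => jl <-.
  by apply: homog_irrel (hom j jl) (pos j jl).
move=> i; rewrite ez mem_cat; apply/orP; right.
by apply: map_f; rewrite -(nth_vars k i) mem_nth // size_vars.
Qed.

Lemma kcomp_up_vars N K nu r (m : kos M r) : size X = r ->
  kcomp grM (nseq n.+1 (N + K)) nu (up (pow K X) m) = up (pow K X) (kcomp grM (nseq n.+1 N) nu m).
Proof.
move=> rX; subst r; apply: kcomp_up => j jX; have jn := jX; rewrite size_vars in jn.
rewrite !nth_nseq jn leq_addr addKn; split=> //.
rewrite (set_nth_default 0) ?size_pow //.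
by have := homog_vars_pow K jX; rewrite nth_nseq jn.
Qed.

Lemma pow_add N K : zmul (pow N X) (pow K X) = pow (N + K) X.
Proof. by have := zmul_pow N K X [::]; rewrite !cats0. Qed.

(* [m] becomes a coboundary modulo [P] in the limit of the complexes K(X_0^N, ..., X_n^N; M). *)
Definition limit_coboundary P i N r (m : kos M r) := exists K b,
  b \in chain full r (i%:Z - 1) /\ up (pow K X) m - kd (pow (N + K) X) b \in chain P r i%:Z.

(** Up to a coboundary [m] is gamma_(l+1) c, and c is the top component of a cocycle over M. The
    annihilator condition bounds one homogeneous part of gamma_(l+1) times that cocycle; modulo
    gamma_1, ..., gamma_l its top component is again a coboundary. *)
Lemma limit_coboundary_descent r l i N nu (m : kos M r) : size X = r -> (l < t)%N -> eps <= i%:Z ->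
  (forall r (z : r.-tuple R) (es : r.-tuple nat), in_ZM M z es ->
    ann_above (@koszul_gr k n M r z gr es (i + l)) (addz mu (- (i + l)%N%:Z)) gamma`_l) ->
  gtz nu (addz mu (- i%:Z + sigma e l)) ->
  cyc full (gamma_sub l) (pow N X) i%:Z m -> kcomp grM (nseq n.+1 N) nu m = m ->
  limit_coboundary (gamma_sub l.+1) i N m -> limit_coboundary (gamma_sub l) i N m.
Proof.
move=> rX; subst r; move=> lt ei ann nuN cm hm [K1 [b1 [b1A e1]]].
(* The zero module is treated apart: its quotients have dimension -1, so Z_M is empty and the
   annihilator condition says nothing. *)
have [[x0 x00]|M0] := pselect (exists x : M, x != 0); last first.
  have M0' x : x = 0 :> M by apply/eqP/negPn/negP => x0; apply: M0; exists x.
  exists 0%N, 0; split; first exact: rpred0.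
  apply: chain_ev => S; first by rewrite [ev _ _]M0' rpred0.
  by move=> _; apply: M0'.
(* The maximum of eps and 0, because the number of parameters is natural. It is still at most i. *)
pose e0 : nat := if 0 <= eps then `|eps|%N else 0%N.
have eps_e0 : eps <= e0%:Z by rewrite /e0; case: ifP; lia.
have e0i : e0%:Z <= i%:Z by rewrite /e0; case: ifP; lia.
have vanish_q q : (q < t)%N -> vanishing_above X (colon (gamma_sub q) (nth 0 gamma q)) (gamma_sub q) e0%:Z.
  by move=> qt; apply: (vanishing_above_colon fgM hJ dimJ reg eps_e0).
have split_ q x : x \in gamma_sub q.+1 -> exists2 p, p \in gamma_sub q & exists y, x = p + gamma`_q *: y.
  exact: smul_take.
have cm1 : cyc full (gamma_sub l) (pow (N + K1) X) i%:Z (up (pow K1 X) m).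
  by rewrite -pow_add; apply: cyc_up.
have [K2 [c [b2 [cc b2A e2]]]] := kernel_cycle split_ vanish_q lt e0i cm1 b1A e1.
have [K3 [c0 cc0 tc0]] := lift_cycle split_ vanish_q (add0n l) (ltnW lt) e0i cc.
rewrite -!addnA in cc0 e2.
(* One more step makes the exponents positive, as membership in Z_M requires. *)
pose K := (K1 + (K2 + (K3 + 1)))%N.
pose z := take l gamma ++ pow (N + K) X.
pose es := take l e ++ nseq n.+1 (N + K).
have sz : size z == (l + size X)%N by rewrite size_cat size_pow size_takel // size_tuple ltnW.
have ses : size es == (l + size X)%N.
  by rewrite size_cat size_nseq size_vars size_takel // size_tuple ltnW.
pose c1 := up (weights X l 1) c0.
have zE : zmul (take l gamma ++ pow (N + (K1 + (K2 + K3))) X) (weights X l 1) = z.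
  have := zmul_weights X (take l gamma) (N + (K1 + (K2 + K3))) 1.
  rewrite size_takel ?size_tuple ?(ltnW lt) // => ->.
  by rewrite /z /K; congr (_ ++ pow _ _); lia.
have cc1 : cyc full (gamma_sub 0) z (i%:Z + l%:Z) c1.
  by rewrite -zE; apply: cyc_up; rewrite -segment_take // ltnW.
(* A cocycle modulo [gamma_sub 0] is a true cocycle over M, this submodule being zero. *)
have dc1 : kd z c1 = 0.
  have P0 x : x \in gamma_sub 0 -> x = 0.
    rewrite /gamma_sub take0 => /asboolP[s + ->]; elim: s => [|p s IH] /=; first by rewrite big_nil.
    by [].
  by apply: ev_inj => S; rewrite ev0; apply/P0/(ev_chain cc1.2).
have il : i%:Z + l%:Z = (i + l)%N%:Z by rewrite PoszD.
have NK : exists N', (N + K)%N = N'.+1 by exists (N + (K1 + (K2 + K3)))%N; rewrite /K; lia.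
case: NK => N' NK.
have ZM : in_ZM M (Tuple sz) (Tuple ses).
  by apply: (@sequence_ZM l N'); rewrite -?NK //; [exists x0|exact: ltnW].
have zes : forall j, tnth (Tuple sz) j \is (tnth (Tuple ses) j).-homog by move=> j; have [[]] := ZM.1 j.
have c1A : c1 \in chain full (l + size X) (i + l)%N%:Z by rewrite -il; exact: cc1.1.
(* The top component of a cochain of degree nu' has degree nu' + deg gamma_1 + ... + deg gamma_l =
   nu, and nu' > mu - (i + l) is exactly the assumption on nu. *)
pose nu' := nu - (sumn (take l e))%:Z.
have nu'N : gtz nu' (addz mu (- (i + l)%N%:Z)).
  by move: nuN; rewrite /nu' /sigma; case: (mu) => //= a; lia.
have [b3 b3A e3] := koszul_kill zes (ann _ _ _ ZM) c1A dc1 nu'N.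
have wP w x : w \in take l gamma -> w *: x \in gamma_sub l by move=> wl; apply: smul_mem.
have st : size (take l gamma) = l by rewrite size_takel // size_tuple ltnW.
have ste : size (take l e) = l by rewrite size_takel // size_tuple ltnW.
pose U (x : kos M (size X)) := up (pow (K3 + 1) X) x.
pose T (x : kos M (size X)) := kcomp grM (nseq n.+1 (N + K)) nu x.
have topE : top (kd z b3) = T (gamma`_l *: U c).
  rewrite [kd z b3]e3 top_kcomp // /nu' subrK /T; congr kcomp.
  by rewrite linearZ /= top_up tc0 up_pow.
have := top_kd (pow (N + K) X) st wP b3A; rewrite -/z topE.
have -> : (i + l)%N%:Z - 1 + 1 - l%:Z = i%:Z by rewrite -il subrK addrK.
move=> e4.
have e5 : T (up (pow K X) m - kd (pow (N + K) X) (U b2) - gamma`_l *: U c) \in chain (gamma_sub l) (size X) i%:Z.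
  apply: chain_kcomp; first by move=> x nu1; apply: gamma_sub_comp.
  have -> : up (pow K X) m - kd (pow (N + K) X) (U b2) - gamma`_l *: U c =
    up (pow (K3 + 1) X) (up (pow K2 X) (up (pow K1 X) m) - kd (pow (N + (K1 + K2)) X) b2 - gamma`_l *: c).
    rewrite !linearB /= [up _ (_ *: c)]linearZ /= !up_pow -up_kd pow_add /K -!addnA; congr (_ - _).
  exact: chain_up.
(* Everything is projected to degree nu by [T], which fixes the image of [m] and commutes with the
   differential. The sign is the one in [top_kd]. *)
exists K, (T (U b2) + (-1) ^+ l *: top b3); split.
  apply: rpredD; first by apply: chain_kcomp => //; apply: chain_up.
  by apply: rpredZ; have := chain_top b3A; rewrite -il addrAC addrK.
have Tm : T (up (pow K X) m) = up (pow K X) m by rewrite /T kcomp_up_vars // hm.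
have Tkd x : T (kd (pow (N + K) X) x) = kd (pow (N + K) X) (T x).
  by apply: kcomp_kd => j jX; apply: homog_vars_pow.
have TB x y : T (x - y) = T x - T y by apply: kcompB.
rewrite linearD linearZ /=.
have := rpredD e5 e4; rewrite !TB Tkd Tm.
by rewrite -[_ - _ + _]addrA addKr [in X in _ -> X]opprD [in X in _ -> X]addrA.
Qed.

End Core.

(** * Comparison with Cech cohomology *)

Section LocMapLinear.
Variables (R : comNzRingType) (S : mulrClosed R) (A B : lmodType R) (f : {linear A -> B}).

Lemma fracDs (m m' : A) (s : denom S) : frac m s + frac m' s = frac (m + m') s.
Proof. by rewrite fracD -scalerDr; apply: fracM. Qed.

Lemma frac0 (s : denom S) : frac (0 : A) s = 0.
Proof. by apply: (addrI (frac 0 s)); rewrite fracDs !addr0. Qed.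

Lemma frac_sum (I : Type) (l : seq I) (P : pred I) (F : I -> A) (s : denom S) :
  \sum_(i <- l | P i) frac (F i) s = frac (\sum_(i <- l | P i) F i) s.
Proof. by apply/esym/(big_morph (fun x => frac x s)) => [x y|]; rewrite ?fracDs ?frac0. Qed.

Lemma frac_eq0 (m : A) (s : denom S) : frac m s = 0 <-> exists2 u, u \in S & u *: m = 0.
Proof.
rewrite -(frac0 (denom1 S)) fracP; split=> -[u uS e]; exists u => //.
  by move: e; rewrite scale1r !scaler0.
by rewrite scale1r !scaler0.
Qed.

Lemma frac_cancel (m : A) (s s' : denom S) c : val s' = c * val s -> frac m s = frac (c *: m) s'.
Proof.
move=> e; apply/fracP; exists 1; first exact: rpred1.
by rewrite e !scalerA; congr (_ *: _); ring.
Qed.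

Lemma loc_map_linear : linear (@loc_map R S A B f).
Proof.
move=> a; elim/fracW=> m s; elim/fracW=> m' s'.
by rewrite fracZ fracD !loc_mapE fracZ fracD linearD ![f (_ *: _)]linearZ.
Qed.
HB.instance Definition _ :=
  GRing.isLinear.Build R (loc S A) (loc S B) _ (@loc_map R S A B f) loc_map_linear.
End LocMapLinear.

Section CochMap.
Variables (R : comNzRingType) (r : nat) (V V' : {set 'I_r} -> lmodType R).
Variable rho : forall (j : 'I_r) (S : {set 'I_r}), {linear V (S :\ j) -> V S}.
Variable rho' : forall (j : 'I_r) (S : {set 'I_r}), {linear V' (S :\ j) -> V' S}.
Variable phi : forall S, {linear V S -> V' S}.
Hypothesis phi_rho : forall j S x, phi S (rho j S x) = rho' j S (phi (S :\ j) x).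

Lemma coch_map_cocycle i (z : cocycles rho i) :
  coch_map phi (cocycle_val z) \in cocycle rho' i.
Proof.
have /andP[/forallP zi /eqP dz] : cocycle_val z \in cocycle rho i := valP z.
rewrite unfold_in /cocycle; apply/andP; split.
  by apply/forallP => S; apply/implyP => Si; rewrite ffunE (eqP (implyP (zi S) Si)) linear0.
have -> : cdiff rho' (coch_map phi z) = coch_map phi (cdiff rho z).
  apply/ffunP => S; rewrite !ffunE linear_sum; apply: eq_bigr => j _.
  by rewrite linearZ phi_rho ffunE.
by rewrite dz; apply/eqP/ffunP => S; rewrite !ffunE linear0.
Qed.
End CochMap.

Section Rep.
Variables (k : fieldType) (n : nat).
Local Notation R := {mpoly k[n.+1]}.
Local Notation X := (vars k n).
Variables (M : lmodType R).

Definition set_mnm N (S : {set 'I_n.+1}) : 'X_{1..n.+1} := [multinom (if j \in S then N else 0)%N | j < n.+1].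

Lemma set_mnm_monom N S : 'X_[set_mnm N S] \in @monoms k n S.
Proof. by apply/asboolP; exists (set_mnm N S) => // j jS; rewrite mnmE (negbTE jS). Qed.

Definition set_denom N S : denom (@monoms k n S) :=
  exist (fun s => s \in @monoms k n S) 'X_[set_mnm N S] (set_mnm_monom N S).

Lemma pow_vars N (j : 'I_n.+1) : (pow N X)`_j = 'X_j ^+ N.
Proof. by rewrite (nth_map 0) ?size_vars // nth_vars. Qed.

Lemma prod_pow_vars N (S : {set 'I_n.+1}) : \prod_(j in S) nth 1 (pow N X) j = 'X_[set_mnm N S].
Proof.
rewrite mpolyXE_id big_mkcond; apply: eq_bigr => j _; rewrite mnmE; case: ifP => _; rewrite ?expr0 //.
by rewrite (set_nth_default 0) ?pow_vars // size_pow size_vars.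
Qed.

Lemma set_mnmD N K S : set_mnm (N + K) S = (set_mnm N S + set_mnm K S)%MM.
Proof. by apply/mnmP => j; rewrite mnmDE !mnmE; case: ifP. Qed.

Lemma set_mnmD1 N (S : {set 'I_n.+1}) j : j \in S -> 'X_[set_mnm N S] = 'X_j ^+ N * 'X_[set_mnm N (S :\ j)] :> R.
Proof.
move=> jS; rewrite mpolyXn -mpolyXD; congr mpolyX; apply/mnmP => l.
rewrite mnmDE mulmnE mnm1E !mnmE !inE eq_sym; case: eqP => [->|_]; rewrite ?jS ?mul1n ?addn0 //.
Qed.

Section OneModule.
Variables (B : lmodType R) (pi : {linear M -> B}).

(** The entry of [m] at S is the numerator over the N-th power of the product of the X_j, j in S.
    With these denominators [up] only expands fractions, and the Koszul differential induces the
    Cech differential. *)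
Definition rep N (m : kos M n.+1) (w : cochain (@cech_mod k n B)) :=
  forall S, w S = frac (pi (ev m S)) (set_denom N S).

Lemma rep_up N K m w : rep N m w -> rep (N + K) (up (pow K X) m) w.
Proof.
move=> h S; rewrite h ev_up prod_pow_vars linearZ; apply: frac_cancel.
by rewrite /= set_mnmD mpolyXD mulrC.
Qed.

Lemma rep_kd N m w : rep N m w -> rep N (kd (pow N X) m) (cdiff (@cech_map k n B) w).
Proof.
move=> h S; rewrite ffunE ev_kd linear_sum -frac_sum; apply: eq_bigr => j jS.
rewrite !linearZ -fracZ; congr (_ *: _); rewrite h.
rewrite -[cech_map _ _ _ _]/(loc_incl _ _) loc_inclE pow_vars; apply: frac_cancel.
exact: set_mnmD1.
Qed.

Lemma repB N m w m' w' : rep N m w -> rep N m' w' -> rep N (m - m') (w - w').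
Proof.
move=> h h' S; have -> : (w - w') S = w S + (-1) *: w' S by rewrite ffunE /= ffunE scaleN1r.
by rewrite h h' fracZ fracDs evB linearB scaleN1r.
Qed.

Lemma rep_chain0 (P : submodClosed M) N m w i : (forall x, x \in P -> pi x = 0) ->
  m \in chain P n.+1 i -> rep N m w -> w = 0.
Proof.
by move=> hP mP h; apply/ffunP => S; rewrite h hP ?frac0 ?ffunE //; apply: ev_chain mP S.
Qed.

(** A vanishing fraction has a numerator killed by a monomial. There are finitely many S, so one
    exponent dominates all these monomials. *)
Lemma rep_eq0 (P : submodClosed M) N m w i : (forall x, pi x = 0 -> x \in P) ->
  m \in chain full n.+1 i -> rep N m w -> w = 0 -> exists K, up (pow K X) m \in chain P n.+1 i.
Proof.
move=> hP mi h w0.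
have hS (S : {set 'I_n.+1}) : exists K, forall L, (K <= L)%N -> 'X_[set_mnm L S] *: pi (ev m S) = 0.
  have : frac (pi (ev m S)) (set_denom N S) = 0 by rewrite -h w0 ffunE.
  move/frac_eq0 => [u /asboolP[mon monS ->] e]; exists (\max_j mon j)%N => L hL.
  have -> : set_mnm L S = (set_mnm L S - mon + mon)%MM.
    rewrite submK //; apply/mnm_lepP => j; rewrite mnmE; case: ifP => jS; last by rewrite monS ?jS.
    exact: leq_trans (leq_bigmax j) hL.
  by rewrite mpolyXD -scalerA e scaler0.
have [K hK] := choice hS; exists (\max_S K S)%N.
apply: chain_ev => S; last first.
  by move=> Si; rewrite ev_up (ev_chain0 mi Si) scaler0.
by rewrite ev_up prod_pow_vars; apply: hP; rewrite linearZ; apply: hK; apply: (leq_bigmax S).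
Qed.

(** The fractions of a cochain are expanded to denominators with one common exponent N. [Q] carries
    a property of the numerators through the expansion: homogeneity for cocycles, nothing for
    bounding cochains. *)
Lemma rep_exists (i : int) (Q : nat -> {set 'I_n.+1} -> M -> Prop) (w : cochain (@cech_mod k n B)) :
  (forall S : {set 'I_n.+1}, #|S|%:Z != i -> w S = 0) -> (forall N S, Q N S 0) ->
  (forall S, exists y (mon : 'X_{1..n.+1}) (hs : 'X_[mon] \in @monoms k n S),
     w S = frac (pi y) (exist (fun s => s \in @monoms k n S) 'X_[mon] hs) /\
     forall N (c : 'X_{1..n.+1}), (c + mon)%MM = set_mnm N S -> Q N S ('X_[c] *: y)) ->
  exists N m, [/\ rep N m w, m \in chain full n.+1 i & forall S, Q N S (ev m S)].
Proof.
move=> wi Q0 hw.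
have hS (S : {set 'I_n.+1}) : exists K, forall L, (K <= L)%N -> exists y : M,
    [/\ w S = frac (pi y) (set_denom L S), #|S|%:Z != i -> y = 0 & Q L S y].
  have [Si|Si] := eqVneq #|S|%:Z i; last first.
    by exists 0%N => L _; exists 0; rewrite wi // linear0 frac0.
  have [y [mon [hs [-> hQ]]]] := hw S; exists (\max_j mon j)%N => L hL.
  have cE : (set_mnm L S - mon + mon)%MM = set_mnm L S.
    have /asboolP[mon' monS /(congr1 (@mlead _ _))] := hs; rewrite !mleadXm => emon.
    rewrite submK //; apply/mnm_lepP => j; rewrite mnmE; case: ifP => jS; last by rewrite emon monS ?jS.
    exact: leq_trans (leq_bigmax j) hL.
  exists ('X_[set_mnm L S - mon] *: y); split=> //; last exact: hQ.
  by rewrite linearZ; apply: frac_cancel; rewrite /= -mpolyXD cE.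
have [K hK] := choice hS; pose N := (\max_S K S)%N.
have [y hy] := choice (fun S => hK S N (leq_bigmax S)).
exists N, (mk y); split=> [S||S]; rewrite ?ev_mk; first by have [] := hy S.
  by apply: chain_ev => S //; rewrite ev_mk; have [_ h _] := hy S.
by have [_ _] := hy S.
Qed.

Lemma rep_frac N m : rep N m (cochain_of (fun S => frac (pi (ev m S)) (set_denom N S))).
Proof. by move=> S; rewrite ffunE. Qed.
End OneModule.
End Rep.

Section Bridge.
Variables (k : fieldType) (n : nat).
Local Notation R := {mpoly k[n.+1]}.
Local Notation X := (vars k n).
Variables (M : lmodType R) (gr : int -> M -> Prop).
Hypothesis grM : is_grading gr.

Lemma mdeg_set_mnm N (S : {set 'I_n.+1}) : mdeg (set_mnm N S) = (#|S| * N)%N.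
Proof.
rewrite mdegE -sum_nat_const [RHS]big_mkcond; apply: eq_bigr => j _.
by rewrite mnmE.
Qed.

Lemma sum_nseq N (S : {set 'I_n.+1}) :
  \sum_(j in S) (nth 0%N (nseq n.+1 N) j)%:Z = (#|S| * N)%N%:Z.
Proof.
under eq_bigr => j _ do rewrite nth_nseq ltn_ord.
by rewrite sumr_const -mulr_natl natz -PoszM.
Qed.

Variables (B B' : lmodType R) (pi : {linear M -> B}) (f : {linear B -> B'}) (grB : int -> B -> Prop).
Variables (P P' : submodClosed M) (i : nat) (nu : int).
Hypothesis grB_lift : forall mu x, grB mu x -> exists2 m, gr mu m & x = pi m.
Hypothesis f_pi_surj : forall x, exists m, x = f (pi m).
Hypothesis P_ker : forall x, x \in P <-> pi x = 0.
Hypothesis P'_ker : forall x, x \in P' <-> f (pi x) = 0.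

Lemma graded_rep (w : cocycles (@cech_map k n B) i) : (forall S, cech_gr grB nu (cocycle_val w S)) ->
  exists N m, [/\ rep pi N m (cocycle_val w), m \in chain full n.+1 i%:Z
    & kcomp grM (nseq n.+1 N) nu m = m].
Proof.
move=> gw; have /andP[/forallP wi _] : cocycle_val w \in cocycle (@cech_map k n B) i := valP w.
have [|||N [m [rm mi Qm]]] := @rep_exists k n M B pi i
    (fun N S y => gr (nu + (#|S| * N)%N%:Z) y) (cocycle_val w).
- by move=> S Si; apply/eqP/(implyP (wi S)).
- by move=> N S; apply: gr0.
- move=> S; have [b [[s hs] [d [sd bd ->]]]] := gw S.
  have /asboolP[mon _ es] := hs; subst s; have [y yd ->] := grB_lift bd.
  exists y, mon, hs; split=> // N c cE.
  have dE : mdeg mon = d.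
    by move: sd; rewrite /= dhomogX => /eqP.
  have [_ hp _ _] := grM; have Xc : ('X_[c] : R) \is (mdeg c).-homog by rewrite dhomogX; apply/eqP.
  by have := hp _ _ _ _ Xc yd; rewrite -mdeg_set_mnm -cE mdegD dE PoszD -addrA [d%:Z + _]addrC.
exists N, m; split=> //; apply: ev_inj => S.
by rewrite ev_kcomp sum_nseq (comp_homog _ _ (Qm S)) eqxx.
Qed.

(** The difference of two classes with the same image is represented by a homogeneous Koszul
    cochain. Equality of the images makes it a coboundary modulo P' in the limit, and a bound modulo
    P gives back a bounding Cech cochain. *)
Lemma inj_bridge :
  (forall N (m : kos M n.+1), cyc full P (pow N X) i%:Z m -> kcomp grM (nseq n.+1 N) nu m = m ->
     limit_coboundary P' i N m -> limit_coboundary P i N m) ->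
  inj_in_degree (@loc_cohom_gr k n B grB i) nu (@loc_cohom_map k n B B' f i).
Proof.
move=> H x y [zx gx ->] [zy gy ->] fxy.
have [Nx [mx [rx mxi hx]]] := graded_rep gx; have [Ny [my [ry myi hy]]] := graded_rep gy.
pose N := (Nx + Ny)%N; pose m0 := up (pow Ny X) mx - up (pow Nx X) my.
have sX := size_vars k n.
have m0i : m0 \in chain full n.+1 i%:Z by rewrite rpredB // chain_up.
have r0 : rep pi N m0 (cocycle_val zx - cocycle_val zy).
  by apply: repB; [|rewrite /N addnC]; apply: rep_up.
have h0 : kcomp grM (nseq n.+1 N) nu m0 = m0.
  by rewrite kcompB kcomp_up_vars // hx /N addnC kcomp_up_vars // hy.
have dw : cdiff (@cech_map k n B) (cocycle_val zx - cocycle_val zy) = 0.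
  have /andP[_ /eqP dx] : cocycle_val zx \in cocycle (@cech_map k n B) i := valP zx.
  have /andP[_ /eqP dy] : cocycle_val zy \in cocycle (@cech_map k n B) i := valP zy.
  by rewrite linearB /= dx dy subrr.
(* The coboundary of [m0] represents 0 but need not have values in P before the exponents are raised
   by [K1]. *)
have [K1 hK1] := rep_eq0 (fun x => (P_ker x).2) (chain_kd (pow N X) m0i) (rep_kd r0) dw.
pose N1 := (N + K1)%N; pose m := up (pow K1 X) m0.
have mi : m \in chain full n.+1 i%:Z by apply: chain_up.
have rm : rep pi N1 m (cocycle_val zx - cocycle_val zy) by apply: rep_up.
have hm : kcomp grM (nseq n.+1 N1) nu m = m by rewrite kcomp_up_vars // h0.
have cm : cyc full P (pow N1 X) i%:Z m by split; rewrite // -pow_add up_kd.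
have phi_rho j S (c : cech_mod B (S :\ j)) :
    loc_map f (cech_map B j S c) = cech_map B' j S (loc_map f c).
  by elim/fracW: c => a s; rewrite /cech_map /= !(loc_inclE, loc_mapE).
pose phi S : {linear cech_mod B S -> cech_mod B' S} := @loc_map R (@monoms k n S) B B' f.
pose zx' := Cocycle (coch_map_cocycle (phi := phi) phi_rho zx).
pose zy' := Cocycle (coch_map_cocycle (phi := phi) phi_rho zy).
have ex : loc_cohom_map f (mq_proj (@coboundary _ _ _ _ i) zx) = mq_proj _ zx'.
  exact: (@cohom_mapE _ _ _ _ _ _ phi).
have ey : loc_cohom_map f (mq_proj (@coboundary _ _ _ _ i) zy) = mq_proj _ zy'.
  exact: (@cohom_mapE _ _ _ _ _ _ phi).
have /mq_eqP/asboolP[g /forallP gi eg] : mq_proj (@coboundary _ _ _ _ i) zx' = mq_proj _ zy'.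
  by rewrite -ex -ey.
pose pi' : {linear M -> B'} := f \o pi.
have rm' : rep pi' N1 m (cocycle_val zx' - cocycle_val zy').
  move=> S; have -> : (cocycle_val zx' - cocycle_val zy') S = loc_map f ((cocycle_val zx - cocycle_val zy) S).
    by rewrite !ffunE linearD linearN.
  by rewrite rm loc_mapE.
have {}eg : cocycle_val zx' - cocycle_val zy' = cdiff (@cech_map k n B') g by [].
have [||S|N2 [b [rb bi _]]] := @rep_exists k n M B' pi' (i%:Z - 1) (fun _ _ _ => True) g.
- move=> S Si; apply/eqP/(implyP (gi S)).
  by apply: contra Si => /eqP <-; rewrite intS addrC addKr.
- by [].
- elim/fracW: (g S) => u [s hs]; have /asboolP[mon _ es] := hs; subst s.
  by have [y0 ->] := f_pi_surj u; exists y0, mon, hs.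
have r2 : rep pi' (N1 + N2) (up (pow N2 X) m - kd (pow (N1 + N2) X) (up (pow N1 X) b))
    (cocycle_val zx' - cocycle_val zy' - cdiff (@cech_map k n B') g).
  by apply: repB; [exact: rep_up|apply: rep_kd; rewrite addnC; exact: rep_up].
have [||K3 h3] := @rep_eq0 k n M B' pi' P' _ _ _ i%:Z (fun x => (P'_ker x).2) _ r2 _.
- rewrite rpredB ?chain_up //.
  by have := chain_kd (pow (N1 + N2) X) (chain_up (pow N1 X) bi); rewrite subrK.
- by rewrite eg subrr.
have [|K4 [b4 [b4i h4]]] := H N1 m cm hm.
  exists (N2 + K3)%N, (up (pow K3 X) (up (pow N1 X) b)); split; first by rewrite !chain_up.
  by rewrite -up_pow addnA -pow_add up_kd -linearB.
apply/mq_eqP/asboolP; exists (cochain_of (fun S => frac (pi (ev b4 S)) (set_denom k (N1 + K4) S))).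
  apply/forallP => S; apply/implyP => Si; rewrite ffunE (ev_chain0 b4i) ?linear0 ?frac0 //.
  by apply: contra Si => /eqP h; apply/eqP; lia.
apply/eqP; rewrite -subr_eq0; apply/eqP.
apply: (rep_chain0 (fun x => (P_ker x).1) h4).
by apply: repB; [exact: rep_up|apply: rep_kd; exact: rep_frac].
Qed.
End Bridge.

Lemma quo_seq_map_linear (k : fieldType) (n : nat) (M : lmodType {mpoly k[n.+1]}) s s' :
  {subset smul (mem s) M <= smul (mem s') M} -> linear (@quo_seq_map k n M s s').
Proof.
move=> ss a; elim/mq_ind => x; elim/mq_ind => y.
rewrite /quo_seq_map -[X in a *: X]/(mq_proj _ x) -[X in _ + X]/(mq_proj _ y).
by rewrite -linearP !mq_mapE // linearP.
Qed.

(** Each step adds deg gamma_j - 1, which is nonnegative. The bound with sigma_(t-1) therefore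
    implies those needed at all earlier steps. *)
Lemma sigma_mono t (e : t.-tuple nat) q q' : (forall j, (0 < tnth e j)%N) ->
  (q <= q' <= t)%N -> sigma e q <= sigma e q'.
Proof.
move=> e0 /andP[qq' q't]; elim: q' qq' q't => [|q' IH]; first by rewrite leqn0 => /eqP->.
rewrite leq_eqVlt => /predU1P[->//|qq'] q't; apply: le_trans (IH qq' (ltnW q't)) _.
rewrite /sigma (take_nth 0%N) ?size_tuple // sumn_rcons.
by have := e0 (Ordinal q't); rewrite (tnth_nth 0%N) /=; lia.
Qed.

Theorem proposition2p4 (k : fieldType) (n : nat)
  (M : lmodType {mpoly k[n.+1]}) (gr : int -> M -> Prop)
  (d : int) (mu : option int)
  (t : nat) (gamma : t.-tuple {mpoly k[n.+1]}) (e : t.-tuple nat)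
  (J : {pred {mpoly k[n.+1]}}) (eps : int) :
  is_grading gr -> fin_gen M -> has_dim M d ->
  partial_sop M d gamma e ->
  homog_ideal J -> dim_le (modquot (smul J M)) eps ->
  regular_outside M J gamma ->
  (forall (l i : nat), (l < t)%N ->
     (eps <= i%:Z /\ i%:Z < d - l%:Z /\
        (forall j : 'I_t, (j <= l)%N -> frakK_hat gr d mu (tnth gamma j)))
     \/ (eps <= i%:Z /\
        (forall j : 'I_t, (j <= l)%N -> frakK gr mu (tnth gamma j))) ->
     forall nu : int, gtz nu (addz mu (- i%:Z + sigma e l)) ->
     inj_in_degree
       (@loc_cohom_gr k n (quo_seq M (take l gamma)) (mq_gr gr) i) nu
       (@loc_cohom_map k n _ _
          (@quo_seq_map k n M (take l gamma) (take l.+1 gamma)) i))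
  /\
  ((0 < t)%N ->
   (forall j : 'I_t, frakK_hat gr d mu (tnth gamma j)) ->
   forall i : nat, eps <= i%:Z -> i%:Z <= d - t%:Z ->
   forall nu : int, gtz nu (addz mu (- i%:Z + sigma e t.-1)) ->
   inj_in_degree (@loc_cohom_gr k n M gr i) nu
     (@loc_cohom_map k n M (quo_seq M gamma) (@mq_proj _ M _) i)).
Proof.
move=> grM fgM _ [gdeg _] hJ dimJ reg.
have gamma_nth l (lt : (l < t)%N) : tnth gamma (Ordinal lt) = gamma`_l by rewrite (tnth_nth 0).
split=> [l i lt hyp nu hnu|t0 hK i ei id nu hnu].
  have ss : {subset smul (mem (take l gamma)) M <= smul (mem (take l.+1 gamma)) M} by apply: gamma_sub_mono.
  pose F : {linear quo_seq M (take l gamma) -> quo_seq M (take l.+1 gamma)} :=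
    HB.pack (@quo_seq_map k n M (take l gamma) (take l.+1 gamma))
      (GRing.isLinear.Build _ _ _ _ _ (quo_seq_map_linear ss)).
  have FE x : F (mq_proj _ x) = mq_proj _ x by apply: mq_mapE.
  pose p : {linear M -> quo_seq M (take l gamma)} := @mq_proj _ M (smul (mem (take l gamma)) M).
  have := @inj_bridge k n M gr grM _ _ p F (mq_gr gr) (gamma_sub M gamma l) (gamma_sub M gamma l.+1) i nu.
  apply => //.
  - by elim/mq_ind => x; exists x; rewrite FE.
  - by move=> x; rewrite mq_proj_eq0.
  - by move=> x; rewrite FE mq_proj_eq0.
  move=> N m; apply: (limit_coboundary_descent fgM gdeg hJ dimJ reg (size_vars k n) lt _ _ hnu).
    by case: hyp => [[]|[]].
  move=> r z es zM; rewrite -gamma_nth; case: hyp => [[_ [il hK]]|[_ hK]]; last exact: hK zM _.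
  by apply: hK zM _ _; rewrite // PoszD; lia.
pose p : {linear M -> quo_seq M gamma} := @mq_proj _ M (smul (mem gamma) M).
have := @inj_bridge k n M gr grM _ _ idfun p gr (gamma_sub M gamma 0) (gamma_sub M gamma t) i nu.
apply => //.
- by move=> mu' x gx; exists x.
- by elim/mq_ind => x; exists x.
- move=> x; rewrite /= /gamma_sub take0; split=> [/asboolP[s + ->]|->]; last exact: rpred0.
  by elim: s => [|a s IH] /=; rewrite ?big_nil.
- by move=> x; rewrite /gamma_sub take_oversize ?size_tuple //= mq_proj_eq0.
(* One cochain [m] over M represents its images in all the quotients M_q, so the gamma can be
   removed one at a time. Step q uses cohomological degree i + q <= i + t - 1 < d, as required for
   the annihilators with a hat. *)
move=> N m [mi dm] hm; suff descent q : (q <= t)%N -> limit_coboundary (gamma_sub M gamma q) i N m ->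
    limit_coboundary (gamma_sub M gamma 0) i N m by exact: descent.
elim: q => [//|q IH] qt dq; apply: (IH (ltnW qt)).
apply: (limit_coboundary_descent fgM gdeg hJ dimJ reg (size_vars k n) qt ei _ _ _ hm dq (mu := mu)).
- move=> r z es zM; rewrite -(gamma_nth _ qt).
  by apply: hK zM _ _; rewrite PoszD; lia.
- have := sigma_mono (q := q) (q' := t.-1) (fun j => (gdeg j).2).
  have -> : (q <= t.-1 <= t)%N by lia.
  by move=> /(_ erefl); move: hnu; case: (mu) => //= a; lia.
by split=> //; apply: chain_sub dm; apply: gamma_sub_mono.
Qed.
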